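(* Let $n$ and $s$ be integers with $n\ge s\ge 0$ and $4n/11\le s\le 3n/8$. Then $\mathrm{ex}(n,s)=6n^2-32ns+44s^2$.
   Context: All graphs are finite and simple. For integers $n\ge s\ge 0$, $\mathrm{ex}(n,s)$ denotes the maximum number of edges in a triangle-free graph on $n$ vertices containing no independent set with more than $s$ vertices. *)

(* Defs.v *)
From mathcomp Require Export all_boot all_order all_algebra.

Set Implicit Arguments.
Unset Strict Implicit.
Unset Printing Implicit Defensive.

(* A simple graph on V is given by its edge set, a set of 2-element subsets. *)
Definition simple_graph (V : finType) (E : {set {set V}}) : bool :=
  [forall e in E, #|e| == 2].

Definition adj (V : finType) (E : {set {set V}}) : rel V :=
  fun x y => [set x; y] \in E.

Definition triangle_free (V : finType) (E : {set {set V}}) : bool :=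
  ~~ [exists x, exists y, exists z, [&& adj E x y, adj E y z & adj E x z]].

Definition independent (V : finType) (E : {set {set V}}) (A : {set V}) : bool :=
  [forall x in A, forall y in A, ~~ adj E x y].

(* ex(n, s). The maximum over an empty family of graphs is 0 by convention, so a
   statement that ex_tf n s is positive includes the existence of such a graph. *)
Definition ex_tf (n s : nat) : nat :=
  \max_(E : {set {set 'I_n}} |
        [&& simple_graph E, triangle_free E
          & [forall A : {set 'I_n}, independent E A ==> (#|A| <= s)]]) #|E|.

(* Main.v *)
(** Write [n = 8 x + 3 y] and [s = 3 x + y] with [0 <= y <= x]; the claimed value is
    [12 x^2 + 8 x y + 2 y^2], attained by blowing up the circulant graph on Z/11 with
    connection set {4, 5, 6, 7}, three classes having size [y] and eight size [x].

    For the upper bound, suppose that the excess [F = (ex(n, s) - g(n, s)) / n^2] is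
    positive somewhere, and take a graph whose excess is almost maximal over all [n] and
    [s]. Perturb it by adding new vertices with an independent neighborhood [B] and by
    removing weight uniformly from a large set [Y]. No perturbation increases the excess
    substantially, so linear programming duality gives a probability measure on the
    independent sets under which a random set [I] avoids each [B] of size about [s] with
    probability at least about [rho], and contains the points of [Y], on average, with
    probability at most about [rho]; here [4/11 <= rho < 3/8] because [F > 0].

    The large independent sets disjoint from a given [A] nearly share a core of size at
    least about [3 s - n], so the probability of avoiding [A] is about [rho] for every
    large [A]. Hence disjointness is an almost regular relation of degree [rho] on the
    large independent sets, triangle-free since [3 s > n]. Sets with different
    neighborhoods have almost disjoint cores, an independent set contains at most three
    of them, and [3 / rho < 9]; the relation is thus a blow-up of a triangle-free graph
    on at most eight vertices. Such a graph has no regular weighting with degree strictly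
    between [1/3] and [3/8]: it is bipartite or contains a pentagon, and the finitely
    many extensions of the pentagon are excluded by explicit dual certificates. *)

Require Import Defs.
From mathcomp Require Import all_boot all_order all_algebra.
From mathcomp Require Import zify ring lra.
Import Order.TTheory GRing.Theory Num.Theory.
Local Open Scope ring_scope.

Set Implicit Arguments.
Unset Strict Implicit.
Unset Printing Implicit Defensive.

(** * Certificates for extensions of the pentagon *)

(* A certificate [(z, a, b)] stands for the multipliers [y i = z i - 2] with
   [\sum_i y i = 3 a - 8 b] and [(M y) i <= a - 3 b] for all [i]. *)
Definition certificate : Type := seq nat * nat * nat.

(* [has] and [all] on call-by-value reduction evaluate the whole list, hence
   these versions, which stop as early as possible. *)
Fixpoint find_has (T : Type) (P : T -> bool) (s : seq T) : bool :=
  if s is x :: s' then if P x then true else find_has P s' else false.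

Fixpoint find_all (T : Type) (P : T -> bool) (s : seq T) : bool :=
  if s is x :: s' then if P x then find_all P s' else false else true.

Definition certifies (M : seq (seq bool)) (c : certificate) : bool :=
  let: (z, a, b) := c in
  find_all (fun row => sumn (mask row z) + 3 * b <= a + 2 * count id row)%N M.

(** Each entry lists shifted multipliers on the pentagon, then on three further vertices, then [a]
    and [b]. The entries are representatives up to the dihedral group of the pentagon and
    permutations of the other three vertices; [pentagon_certificates] restores the symmetric
    copies. *)
Definition pentagon_certificate_base : seq (seq nat * seq nat * nat * nat) :=
  [:: ([:: 2; 3; 3; 3; 3], [:: 2; 3; 3], 2, 0);
      ([:: 1; 1; 1; 2; 2], [:: 2; 2; 3], 2, 1);
      ([:: 1; 1; 1; 1; 3], [:: 0; 2; 2], 1, 1);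
      ([:: 1; 1; 2; 3; 2], [:: 2; 3; 3], 3, 1);
      ([:: 1; 1; 2; 2; 3], [:: 0; 2; 3], 2, 1);
      ([:: 1; 2; 1; 2; 2], [:: 1; 2; 3], 2, 1);
      ([:: 1; 1; 1; 1; 1], [:: 2; 2; 2], 1, 1);
      ([:: 1; 1; 1; 2; 3], [:: 1; 2; 3], 2, 1);
      ([:: 2; 2; 3; 3; 3], [:: 3; 3; 3], 2, 0);
      ([:: 0; 1; 1; 2; 2], [:: 2; 3; 3], 2, 1);
      ([:: 1; 1; 1; 1; 2], [:: 2; 3; 3], 2, 1);
      ([:: 1; 1; 1; 1; 1], [:: 1; 1; 1], 0, 1)]%N.

Definition pentagon_certificates : seq certificate :=
  flatten [seq let: (p, q, a, b) := c in
    [seq (p' ++ q', a, b) |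
       p' <- [seq rot i p | i <- iota 0 5] ++ [seq rot i (rev p) | i <- iota 0 5],
       q' <- permutations q] | c <- pentagon_certificate_base].

Definition pentagon_matrix (p q t : seq bool) (f g h : bool) : seq (seq bool) :=
  [seq [seq (j == i.+1 %% 5) || (i == j.+1 %% 5) | j <- iota 0 5]%N ++
       [:: nth false p i; nth false q i; nth false t i] | i <- iota 0 5] ++
  [:: p ++ [:: false; f; g]; q ++ [:: f; false; h]; t ++ [:: g; h; false]].

Fixpoint bitseqs (n : nat) : seq (seq bool) :=
  if n is m.+1 then [seq b :: s | b <- [:: true; false], s <- bitseqs m] else [:: [::]].

Definition pentagon_patterns : seq (seq bool) :=
  [seq p <- bitseqs 5 |
   all (fun i => ~~ (nth false p i && nth false p (i.+1 %% 5)%N)) (iota 0 5)].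

Definition disjoint_patterns (p q : seq bool) : bool :=
  all (fun i => ~~ (nth false p i && nth false q i)) (iota 0 5).

Definition proper_certificate (c : certificate) : bool :=
  let: (z, a, b) := c in
  [&& size z == 8, all (fun k => k <= 4)%N z, (0 < a + b)%N &
      (sumn z + 8 * b == 3 * a + 16)%N].

(** In a triangle-free graph the neighbors of a further vertex on the pentagon are independent, so
    after a rotation they lie in positions [{0, 2}]. Normalizing one vertex in this way shortens the
    enumeration. *)
Definition rooted_patterns : seq (seq bool) :=
  [seq [:: a; false; b; false; false] | a <- [:: true; false], b <- [:: true; false]].

(** The skipped cases contain a triangle: adjacent further vertices with a common neighbor on the
    pentagon, or three mutually adjacent further vertices. *)
Definition certified_extensions (certs : seq certificate) : bool :=
  let bs := [:: true; false] in
  find_all (fun p => find_all (fun q => find_all (fun f =>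
    if f && ~~ disjoint_patterns p q then true else
  find_all (fun t => find_all (fun g =>
    if g && ~~ disjoint_patterns p t then true else
  find_all (fun h => if h && ~~ disjoint_patterns q t then true else
     if [&& f, g & h] then true else
     find_has (certifies (pentagon_matrix p q t f g h)) certs)
   bs) bs) pentagon_patterns) bs) pentagon_patterns) rooted_patterns.

Lemma pentagon_certificates_proper : all proper_certificate pentagon_certificates.
Proof. by vm_compute. Qed.

Lemma certified_extensionsP : certified_extensions pentagon_certificates.
Proof. by vm_compute. Qed.

(** * Soundness of the certificate check *)

Lemma find_hasE (T : Type) (P : T -> bool) (s : seq T) : find_has P s = has P s.
Proof. by elim: s => //= x s ->. Qed.

Lemma find_allE (T : Type) (P : T -> bool) (s : seq T) : find_all P s = all P s.
Proof. by elim: s => //= x s ->. Qed.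

Lemma sumn_mask_mkseq (b : nat -> bool) (z : seq nat) :
  sumn (mask (mkseq b (size z)) z) = (\sum_(j < size z) b j * nth 0 z j)%N.
Proof.
elim: z b => [|k z IH] b; first by rewrite big_ord0.
rewrite /= big_ord_recl /mkseq /=.
have -> : map b (iota 1 (size z)) = [seq b j.+1 | j <- iota 0 (size z)].
  by rewrite (iotaDl 1 0) -map_comp.
have := IH (fun j => b j.+1); rewrite /mkseq /= => IH'.
by case: (b 0%N) => /=; rewrite IH' ?mul1n ?mul0n.
Qed.

Lemma count_mkseq (b : nat -> bool) (n : nat) :
  count id (mkseq b n) = (\sum_(j < n) b j)%N.
Proof.
rewrite /mkseq count_map -sum1_count big_mkcond -(big_mkord xpredT (fun i => nat_of_bool (b i))) /index_iota subn0.
by apply: eq_bigr => i _ /=; case: (b i).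
Qed.

Definition rel_matrix (M : rel nat) : seq (seq bool) := mkseq (fun i => mkseq (M i) 8) 8.

(* Weak duality: pair the almost regular weighting with the multipliers [y = z - 2]. *)
Lemma certificate_absurd (R : realFieldType) (M : rel nat) (w : nat -> R)
    (r c eps : R) (crt : certificate) :
  symmetric M -> proper_certificate crt -> certifies (rel_matrix M) crt ->
  (forall i, 0 <= w i) -> 1 - eps <= \sum_(j < 8) w j <= 1 ->
  (forall i : nat, r - eps <= \sum_(j < 8) (M i j)%:R * w j <= r + eps) ->
  0 < c -> 0 <= eps -> 6 * eps <= c -> 4 / 11 <= r -> r <= 3 / 8 - c -> False.
Proof.
case: crt => [[z a] b] Msym /and4P[/eqP sz /allP z4 ab0 /eqP sumz].
rewrite /certifies find_allE => /allP cert w0 /andP[W0 W1] deg cpos eps0 epsc r0 rc.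
set W := \sum_(j < 8) w j in W0 W1.
pose y (i : nat) : R := (nth 0%N z i)%:R - 2.
have y2 (i : nat) : `|y i| <= 2.
  have : (nth 0%N z i <= 4)%N.
    case: (ltnP i (size z)) => iz; last by rewrite nth_default.
    by apply: z4; apply: mem_nth.
  rewrite -(ler_nat R) => h; rewrite ler_norml /y.
  have := ler0n R (nth 0%N z i); lra.
have Sy : \sum_(i < 8) y i = 3 * a%:R - 8 * b%:R.
  rewrite /y big_split /= sumrN big_const_ord iter_addr_0 -natr_sum.
  have -> : (\sum_(i < 8) nth 0 z i)%N = sumn z.
    by rewrite sumnE (big_nth 0%N) sz big_mkord.
  have := congr1 (fun k => k%:R : R) sumz.
  rewrite !natrD ?natrM; set t := (sumn z)%:R; lra.
have row (i : nat) : (i < 8)%N ->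
    \sum_(j < 8) (M i j)%:R * y j <= a%:R - 3 * b%:R.
  move=> i8.
  have /cert : mkseq (M i) 8 \in rel_matrix M.
    by apply/mapP; exists i; rewrite // mem_iota.
  have := sumn_mask_mkseq (M i) z; rewrite sz => ->; rewrite count_mkseq -(ler_nat R) !natrD ?natrM !natr_sum => h.
  rewrite /y; under eq_bigr => j _ do rewrite mulrBr.
  rewrite big_split /= sumrN -mulr_suml.
  under eq_bigr do rewrite -natrM.
  lra.
have up : \sum_(i < 8) y i * (\sum_(j < 8) (M i j)%:R * w j) <= (a%:R - 3 * b%:R) * W.
  under eq_bigr do rewrite mulr_sumr.
  rewrite exchange_big /= /W mulr_sumr; apply: ler_sum => j _.
  have := ler_wpM2r (w0 j) (row j (ltn_ord j)).
  apply: le_trans; rewrite mulr_suml; apply: ler_sum => i _.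
  by rewrite Msym mulrCA mulrA.
have lo : r * (3 * a%:R - 8 * b%:R) - 16 * eps <=
    \sum_(i < 8) y i * (\sum_(j < 8) (M i j)%:R * w j).
  have -> : 16 * eps = \sum_(i < 8) 2 * eps.
    rewrite big_const_ord iter_addr_0; lra.
  rewrite -Sy mulr_sumr -sumrB; apply: ler_sum => i _.
  have /andP[d0 d1] := deg i; move: d0 d1 (y2 i); rewrite ler_norml.
  set d := \sum_(j < 8) _; set v := y i => d0 d1 /andP[v0 v1].
  nra.
have A0 := ler0n R a; have B0 := ler0n R b.
have AB : 1 <= a%:R + b%:R :> R by rewrite -natrD ler1n.
(* For [eps = 0] and [W = 1] this reads [a * (3 * r - 1) + b * (3 - 8 * r) <= 0], impossible for
   [1/3 < r < 3/8]. The remaining steps absorb the errors into the margins [1/11] and [8 * c] of the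
   two factors. *)
move: (le_trans lo up) => key.
have h1 : 17 * eps * a%:R <= a%:R * (3 * r - W) by rewrite mulrC; apply: ler_wpM2l => //; lra.
have h2 : 19 * eps * b%:R + 3 * c / 3 * b%:R <= b%:R * (3 * W - 8 * r).
  by rewrite -mulrDl mulrC; apply: ler_wpM2l => //; lra.
have h3 : a%:R * (3 * r - W) + b%:R * (3 * W - 8 * r) <= 16 * eps by nra.
have h4 : 1 / 22 * a%:R <= a%:R * (3 * r - W - 16 * eps).
  by rewrite mulrC; apply: ler_wpM2l => //; lra.
have h5 : 16 * eps <= 16 * eps * (a%:R + b%:R) by nra.
case: (posnP a) => [a0|a0]; last first.
  have : 1 <= a%:R :> R by rewrite ler1n.
  have : 0 <= c * b%:R by apply: mulr_ge0 => //; lra.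
  have : 0 <= eps * b%:R by apply: mulr_ge0 => //; lra.
  nra.
have a0' : a%:R = 0 :> R by rewrite a0.
rewrite a0' in AB h3 h5 key.
have : 0 <= eps * b%:R by apply: mulr_ge0.
have : c <= c * b%:R by nra.
nra.
Qed.

Definition triangle_free_rel (T : Type) (e : rel T) : Prop :=
  forall x y z, e x y -> e y z -> e x z -> False.

Lemma pentagon_matrix_certificate (p q t : seq bool) (f g h : bool) :
  p \in rooted_patterns -> q \in pentagon_patterns -> t \in pentagon_patterns ->
  f ==> disjoint_patterns p q -> g ==> disjoint_patterns p t ->
  h ==> disjoint_patterns q t -> ~~ [&& f, g & h] ->
  exists2 crt, proper_certificate crt & certifies (pentagon_matrix p q t f g h) crt.
Proof.
move=> pP qP tP fP gP hP fghP.
have N (x y : bool) : x ==> y -> (x && ~~ y) = false by case: x; case: y.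
have := certified_extensionsP.
move: pentagon_certificates pentagon_certificates_proper => certs /allP certsP.
rewrite /certified_extensions find_allE => /allP/(_ _ pP).
rewrite find_allE => /allP/(_ _ qP).
rewrite find_allE => /allP/(_ f).
have -> : f \in [:: true; false] by case: (f).
move=> /(_ isT); rewrite (N _ _ fP).
rewrite find_allE => /allP/(_ _ tP).
rewrite find_allE => /allP/(_ g).
have -> : g \in [:: true; false] by case: (g).
move=> /(_ isT); rewrite (N _ _ gP).
rewrite find_allE => /allP/(_ h).
have -> : h \in [:: true; false] by case: (h).
move=> /(_ isT); rewrite (N _ _ hP).
rewrite (negbTE fghP) find_hasE => /hasP[crt crtP ok]; exists crt => //.
exact: certsP.
Qed.

(** * Triangle-free graphs on at most eight vertices containing a pentagon *)

Section Pentagon.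

Variables (T : finType) (e : rel T) (c0 c1 c2 c3 c4 : T).
Hypotheses (esym : symmetric e) (etf : triangle_free_rel e).
Hypotheses (e01 : e c0 c1) (e12 : e c1 c2) (e23 : e c2 c3) (e34 : e c3 c4) (e40 : e c4 c0).

Lemma triangle_freeF (x y z : T) : e x y -> e y z -> e x z = false.
Proof. by move=> xy yz; apply/negP => /(etf xy yz). Qed.

Lemma triangle_free_irr (x : T) : e x x = false.
Proof. by apply/negP => xx; apply: (etf xx xx xx). Qed.

Lemma pentagon_pattern (z : T) :
  [:: e z c0; e z c1; e z c2; e z c3; e z c4] \in pentagon_patterns.
Proof.
have n x y : e x y -> ~~ (e z x && e z y).
  by move=> xy; apply/negP => /andP[zx zy]; apply: (etf zx xy zy).
rewrite mem_filter /= !n // ?(esym c4) //=.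
by case: (e z c0); case: (e z c1); case: (e z c2); case: (e z c3); case: (e z c4).
Qed.

Lemma adjacent_patterns (z a : T) : e z a ==>
  disjoint_patterns [:: e z c0; e z c1; e z c2; e z c3; e z c4]
                    [:: e a c0; e a c1; e a c2; e a c3; e a c4].
Proof.
apply/implyP => za.
have n x : ~~ (e z x && e a x) by apply/negP => /andP[zx ax]; apply: (etf za ax zx).
by rewrite /disjoint_patterns /= !n.
Qed.

Lemma rooted_pentagon_certificate (z a b : T) :
  ~~ e z c1 -> ~~ e z c3 -> ~~ e z c4 ->
  let s := [:: c0; c1; c2; c3; c4; z; a; b] in
  exists2 crt, proper_certificate crt &
    certifies (rel_matrix (fun i j => e (nth c1 s i) (nth c1 s j))) crt.
Proof.
move=> z1 z3 z4 s.
pose P x := [:: e x c0; e x c1; e x c2; e x c3; e x c4].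
have Pz : P z \in rooted_patterns.
  by rewrite /P (negbTE z1) (negbTE z3) (negbTE z4); case: (e z c0); case: (e z c2).
have fgh : ~~ [&& e z a, e z b & e a b].
  by apply/negP => /and3P[za zb ab]; apply: (etf za ab zb).
have [crt crtP ok] := pentagon_matrix_certificate Pz (pentagon_pattern a)
  (pentagon_pattern b) (adjacent_patterns z a) (adjacent_patterns z b)
  (adjacent_patterns a b) fgh.
exists crt => //; suff -> : rel_matrix (fun i j => e (nth c1 s i) (nth c1 s j)) =
  pentagon_matrix (P z) (P a) (P b) (e z a) (e z b) (e a b) by [].
have E x y : e x y -> e y x by rewrite esym.
rewrite /rel_matrix /mkseq /= /pentagon_matrix /=.
rewrite !triangle_free_irr e01 e12 e23 e34 e40 (E _ _ e01) (E _ _ e12) (E _ _ e23)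
  (E _ _ e34) (E _ _ e40).
rewrite (triangle_freeF e01 e12) (triangle_freeF e12 e23) (triangle_freeF e23 e34)
  (triangle_freeF e34 e40) (triangle_freeF e40 e01).
rewrite (triangle_freeF (E _ _ e12) (E _ _ e01)) (triangle_freeF (E _ _ e23) (E _ _ e12))
 (triangle_freeF (E _ _ e34) (E _ _ e23)) (triangle_freeF (E _ _ e40) (E _ _ e34))
 (triangle_freeF (E _ _ e01) (E _ _ e40)).
by rewrite /P !(esym _ z) !(esym _ a) !(esym _ b).
Qed.

End Pentagon.

Definition near_regular (R : realFieldType) (T : finType) (e : rel T) (l : T -> R) (r eps : R) : Prop :=
  [/\ forall x, 0 <= l x, 1 - eps <= \sum_x l x <= 1 &
      forall x, r - eps <= \sum_(y | e x y) l y <= r + eps].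

Lemma sum_enumeration (R : realFieldType) (T : finType) (d : T) (s : seq T) (n : nat) (l : T -> R) :
  uniq s -> (forall x, x \in s) -> (size s <= n)%N ->
  \sum_(j < n) (if (j < size s)%N then l (nth d s j) else 0) = \sum_x l x.
Proof.
move=> us sT sn.
rewrite [RHS](perm_big s) /=; last first.
  by apply: uniq_perm; rewrite ?index_enum_uniq // => x; rewrite mem_index_enum sT.
rewrite (big_nth d) big_mkord (big_ord_widen n (fun j => l (nth d s j))) //.
by rewrite [RHS]big_mkcond.
Qed.

Section Pentagon.

Variables (R : realFieldType) (T : finType) (e : rel T) (l : T -> R) (r c eps : R).
Hypotheses (T8 : (#|T| <= 8)%N) (esym : symmetric e) (etf : triangle_free_rel e).
Hypothesis reg : near_regular e l r eps.
Hypotheses (cpos : 0 < c) (eps0 : 0 <= eps) (epsc : 6 * eps <= c).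
Hypotheses (r0 : 4 / 11 <= r) (rc : r <= 3 / 8 - c).

Lemma rooted_pentagon_absurd (c0 c1 c2 c3 c4 : T) (rest : seq T) :
  e c0 c1 -> e c1 c2 -> e c2 c3 -> e c3 c4 -> e c4 c0 ->
  let s := [:: c0, c1, c2, c3, c4 & rest] in
  uniq s -> (forall x, x \in s) ->
  let z := nth c1 rest 0 in ~~ e z c1 -> ~~ e z c3 -> ~~ e z c4 -> False.
Proof.
move=> e01 e12 e23 e34 e40 s us sT z z1 z3 z4.
have ss : (size s <= 8)%N.
  by apply: leq_trans T8; rewrite cardE -(card_uniqP us) cardE uniq_leq_size ?enum_uniq // => x; rewrite !mem_enum.
have [crt crtP] := rooted_pentagon_certificate esym etf e01 e12 e23 e34 e40
  (nth c1 rest 1) (nth c1 rest 2) z1 z3 z4.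
(* If there are fewer than eight vertices, the list is padded with copies of [c1], whose neighbors
   on the pentagon are [c0] and [c2], as a rooted vertex requires. The copies get weight zero in
   [w]. *)
set s' := [:: c0; _; _; _; _; _; _; _].
have ss' i : nth c1 s' i = nth c1 s i.
  rewrite /s /s' /z; case: i => [|[|[|[|[|i]]]]] //=.
  move: ss; rewrite /s /=; clear.
  by case: rest => [|a [|b [|d [|? ?]]]] //= _; case: i => [|[|[|i]]] //=; rewrite ?nth_nil.
rewrite (_ : rel_matrix _ = rel_matrix (fun i j => e (nth c1 s i) (nth c1 s j))); last first.
  by apply: eq_map => i; apply: eq_map => j; rewrite !ss'.
move=> ok; case: reg => l0 tot deg.
pose w (j : nat) := if (j < size s)%N then l (nth c1 s j) else 0.
apply: (certificate_absurd (w := w) (r := r) (c := c) (eps := eps) _ crtP ok) => //.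
- by move=> i; rewrite /w; case: ifP => // _; apply: l0.
- by rewrite sum_enumeration.
move=> i; have := deg (nth c1 s i).
rewrite big_mkcond -(sum_enumeration c1 (n := 8) _ us sT) //.
rewrite (eq_bigr (fun j : 'I_8 => (e (nth c1 s i) (nth c1 s j))%:R * w j)) // => j _.
by rewrite /w; case: ifP => _; case: (e _ _); rewrite ?mul1r ?mul0r.
Qed.

(** A closed walk of length five in a triangle-free graph has distinct vertices. The first vertex
    [z] outside it has independent neighbors on the pentagon, so one of the five rotations makes [z]
    rooted. *)
Lemma pentagon_absurd (c0 c1 c2 c3 c4 : T) :
  e c0 c1 -> e c1 c2 -> e c2 c3 -> e c3 c4 -> e c4 c0 -> False.
Proof.
move=> e01 e12 e23 e34 e40.
have ne x y : e x y -> x != y.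
  by move=> xy; apply/eqP => E; move: xy; rewrite E triangle_free_irr.
have ne2 x y z w : e x y -> e y z -> e z w -> x != w.
  by move=> xy yz zw; apply/eqP => E; rewrite -E in zw; apply: (etf xy yz); rewrite esym.
pose C := [:: c0; c1; c2; c3; c4].
have uC : uniq C.
  have d02 : c0 != c2 by rewrite eq_sym (ne2 _ _ _ _ e23 e34 e40).
  have d03 : c0 != c3 by rewrite (ne2 _ _ _ _ e01 e12 e23).
  have d04 : c0 != c4 by rewrite eq_sym ne.
  have d13 : c1 != c3 by rewrite eq_sym (ne2 _ _ _ _ e34 e40 e01).
  have d14 : c1 != c4 by rewrite (ne2 _ _ _ _ e12 e23 e34).
  have d24 : c2 != c4 by rewrite eq_sym (ne2 _ _ _ _ e40 e01 e12).
  by rewrite /= !inE !negb_or d02 d03 d04 d13 d14 d24 !ne.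
pose rest := [seq x <- enum T | x \notin C].
have us : uniq (C ++ rest).
  rewrite cat_uniq uC filter_uniq ?enum_uniq // andbT /=.
  by apply/hasPn => x; rewrite mem_filter => /andP[].
have sT x : x \in C ++ rest.
  by rewrite mem_cat mem_filter mem_enum andbT orbN.
have us' k : uniq (rot k C ++ rest) by rewrite (perm_uniq (_ : perm_eq _ (C ++ rest))) // perm_cat2r perm_rot.
have sT' k x : x \in rot k C ++ rest.
  by rewrite (perm_mem (_ : perm_eq _ (C ++ rest))) ?sT // perm_cat2r perm_rot.
have A0 := rooted_pentagon_absurd e01 e12 e23 e34 e40 (us' 0%N) (sT' 0%N).
have A1 := rooted_pentagon_absurd e12 e23 e34 e40 e01 (us' 1%N) (sT' 1%N).
have A2 := rooted_pentagon_absurd e23 e34 e40 e01 e12 (us' 2%N) (sT' 2%N).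
have A3 := rooted_pentagon_absurd e34 e40 e01 e12 e23 (us' 3%N) (sT' 3%N).
have A4 := rooted_pentagon_absurd e40 e01 e12 e23 e34 (us' 4%N) (sT' 4%N).
move: (rest) A0 A1 A2 A3 A4 => [|z rst] /=.
  move=> A0 _ _ _ _; apply: A0; first by rewrite triangle_free_irr.
    by rewrite (triangle_freeF etf e12 e23).
  by rewrite esym (triangle_freeF etf e40 e01).
have n x y : e x y -> ~~ (e z x && e z y).
  by move=> xy; apply/negP => /andP[zx zy]; apply: (etf zx xy zy).
have := n _ _ e01; have := n _ _ e12; have := n _ _ e23; have := n _ _ e34; have := n _ _ e40.
case: (e z c0); case: (e z c1); case: (e z c2); case: (e z c3); case: (e z c4) => //=; tauto.
Qed.

End Pentagon.

(** * Almost regular weightings of small triangle-free graphs *)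

Lemma ler_sum_cond (R : realFieldType) (T : finType) (P Q : pred T) (l : T -> R) :
  (forall x, 0 <= l x) -> (forall x, P x -> Q x) ->
  \sum_(x | P x) l x <= \sum_(x | Q x) l x.
Proof.
move=> l0 PQ; rewrite [X in X <= _]big_mkcond [X in _ <= X]big_mkcond.
by apply: ler_sum => x _; case: ifP => [/PQ->|_] //; case: ifP.
Qed.

(* Each vertex of one class [P] is missed by some vertex of the other, and a vertex
   outside [P] misses a subset of [P] of weight about [1/2 - r], which lies strictly
   between [1/8] and [1/6]; so [P] cannot be covered by at most four such subsets. *)
Lemma bipartite_absurd (R : realFieldType) (T : finType) (e : rel T) (l : T -> R)
    (r c eps : R) (P : {set T}) :
  symmetric e -> near_regular e l r eps ->
  0 < c -> 0 <= eps -> 6 * eps <= c -> 4 / 11 <= r -> r <= 3 / 8 - c ->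
  (forall x y, e x y -> (x \in P) = (y \notin P)) -> (#|P| <= 4)%N -> False.
Proof.
move=> esym [l0 /andP[W0 W1] deg] cpos eps0 epsc r0 rc bip P4.
pose p := \sum_(x in P) l x; pose q := \sum_(x | x \notin P) l x.
have Wpq : \sum_x l x = p + q by rewrite /p /q (bigID (mem P)).
(* Both sides count the weighted edges between the classes; hence the classes have almost equal
   weight, about [1/2] each. *)
have pq : \sum_(x in P) l x * (\sum_(y | e x y) l y) =
          \sum_(y | y \notin P) l y * (\sum_(x | e y x) l x).
  under eq_bigr do rewrite mulr_sumr.
  rewrite (exchange_big_dep (fun y => y \notin P)) /=; last first.
    by move=> x y xP /bip; rewrite xP.
  apply: eq_bigr => y yP; rewrite mulr_sumr; apply: eq_big => [x|x _]; last by rewrite mulrC.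
  rewrite esym; case xy: (e y x); rewrite ?andbF // andbT.
  by apply/negPn; rewrite -(bip y x xy) (negbTE yP).
have up (Q : pred T) : \sum_(x | Q x) l x * (\sum_(y | e x y) l y) <= (\sum_(x | Q x) l x) * (r + eps).
  rewrite mulr_suml; apply: ler_sum => x _; apply: ler_wpM2l => //; by case/andP: (deg x).
have lo (Q : pred T) : (\sum_(x | Q x) l x) * (r - eps) <= \sum_(x | Q x) l x * (\sum_(y | e x y) l y).
  rewrite mulr_suml; apply: ler_sum => x _; apply: ler_wpM2l => //; by case/andP: (deg x).
have p0 : 0 <= p by apply: sumr_ge0.
have q0 : 0 <= q by apply: sumr_ge0.
have h1 : p * (r - eps) <= q * (r + eps) by apply: le_trans (lo (mem P)) _; rewrite pq up.
have h2 : q * (r - eps) <= p * (r + eps).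
  by apply: le_trans (lo (fun x => x \notin P)) _; rewrite -pq up.
have pu : p <= 1 / 2 + 2 * eps.
  rewrite leNgt; apply/negP => h.
  have : q <= 1 - p by lra.
  nra.
have qu : q <= 1 / 2 + 2 * eps.
  rewrite leNgt; apply/negP => h.
  have : p <= 1 - q by lra.
  nra.
pose S y := \sum_(x in P | ~~ e y x) l x.
have SE y : y \notin P -> 1 / 8 + c - 4 * eps <= S y <= 3 / 22 + 3 * eps.
  move=> yP; have : p = S y + \sum_(x | e y x) l x.
    rewrite /p (bigID (e y)) /= addrC; congr (_ + _); apply: eq_bigl => x.
    case xy: (e y x); rewrite ?andbF // andbT; apply/negPn.
    by rewrite -(bip y x xy) (negbTE yP).
  have /andP[] := deg y; move: (\sum_(x | _) _) (S y) => D s; lra.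
have miss x : exists y, (x \in P) ==> (y \notin P) && ~~ e y x.
  case xP: (x \in P); last by exists x.
  apply/existsP; rewrite -[[exists _, _]]negbK negb_exists; apply/negP => /forallP/= all.
  have : q <= \sum_(y | e x y) l y.
    apply: ler_sum_cond => // y yP; have := all y; rewrite yP /= negbK esym //.
  have /andP[] := deg x; move: (\sum_(y | _) _) => D; lra.
pose f x := xchoose (miss x).
have fP x : x \in P -> (f x \notin P) /\ ~~ e (f x) x.
  by move=> xP; have /implyP/(_ xP)/andP := xchooseP (miss x).
have cover (Q : {set T}) : Q \subset P -> (#|Q| <= 3)%N ->
    (forall x, x \in P -> exists2 y, y \in Q & ~~ e (f y) x) -> False.
  move=> QP Q3 cov.
  have h : p <= \sum_(y in Q) S (f y).
    rewrite /S (exchange_big_dep (mem P)) /=; last by move=> y x _ /andP[].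
    apply: ler_sum => x xP; have [y yQ yx] := cov x xP.
    rewrite (bigD1 y) /=; last by rewrite yQ xP.
    by rewrite lerDl; apply: sumr_ge0.
  have : \sum_(y in Q) S (f y) <= 3 * (3 / 22 + 3 * eps).
    apply: le_trans (_ : \sum_(y in Q) (3 / 22 + 3 * eps) <= _).
      apply: ler_sum => y yQ; have [yP _] := fP y (subsetP QP y yQ).
      by case/andP: (SE _ yP).
    rewrite big_const iter_addr_0 -[_ *+ #|Q|]mulr_natl; apply: ler_wpM2r; first lra.
    by rewrite ler_nat.
  move: (\sum_(y in Q) _) h => t h; lra.
case: (leqP #|P| 3) => P3.
  by apply: (cover P) => // x xP; exists x => //; case: (fP x xP).
(* There are four vertices in [P]. If each [f x] misses only [x], the four missed sets partition [P]
   and weigh more than [1/2] together. Otherwise some [f x] also misses [y], and the other three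
   sets cover [P]. *)
case: (boolP [forall x in P, forall y in P, (y != x) ==> e (f x) y]) => [single|].
  have h : p = \sum_(x in P) S (f x).
    apply: eq_bigr => x xP; rewrite /S (bigD1 x) /=; last first.
      by rewrite xP; case: (fP x xP).
    rewrite big1 ?addr0 // => y /andP[/andP[yP fy] yx].
    by move/forall_inP: single => /(_ x xP) /forall_inP/(_ y yP); rewrite yx (negbTE fy).
  have : \sum_(x in P) (1 / 8 + c - 4 * eps) <= \sum_(x in P) S (f x).
    by apply: ler_sum => x xP; have [yP _] := fP x xP; case/andP: (SE _ yP).
  rewrite big_const iter_addr_0 -[_ *+ #|P|]mulr_natl -h.
  have -> : #|P| = 4%N by apply/eqP; rewrite eqn_leq P4 P3.
  lra.
rewrite negb_forall_in => /exists_inP[x xP]; rewrite negb_forall_in => /exists_inP[y yP].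
rewrite negb_imply => /andP[yx fxy].
apply: (cover (P :\ y)).
- exact: subD1set.
- by move: P4; rewrite (cardsD1 y P) yP.
move=> z zP; have [->|zy] := eqVneq z y; first by exists x => //; rewrite !inE eq_sym yx xP.
by exists z; [rewrite !inE zy zP | case: (fP z zP)].
Qed.

(** As [r > 1/3], among any three vertices two have a common neighbor. Fix an edge [x0 y0], and let
    [P] and [Q] collect the vertices sharing a neighbor with [y0] and [x0]. Lying in both closes a
    walk of length five; lying in neither contradicts the first remark, as does an edge inside [P]
    or [Q]. So the graph is bipartite, with a class of at most four vertices. *)
Lemma near_regular_absurd (R : realFieldType) (T : finType) (e : rel T) (l : T -> R)
    (r c eps : R) :
  (#|T| <= 8)%N -> symmetric e -> triangle_free_rel e -> near_regular e l r eps ->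
  0 < c -> 0 <= eps -> 6 * eps <= c -> 4 / 11 <= r -> r <= 3 / 8 - c -> False.
Proof.
move=> T8 esym etf reg cpos eps0 epsc r0 rc.
have nopent := pentagon_absurd T8 esym etf reg cpos eps0 epsc r0 rc.
case: (reg) => l0 /andP[W0 W1] deg.
have three x y z : (exists w, (e x w && e y w) || (e x w && e z w) || (e y w && e z w)).
  apply/existsP; rewrite -[[exists _, _]]negbK negb_exists; apply/negP => /forallP/= disj.
  have : \sum_(w | e x w) l w + \sum_(w | e y w) l w + \sum_(w | e z w) l w <= \sum_w l w.
    rewrite ![\sum_(w | e _ w) _]big_mkcond -!big_split /=; apply: ler_sum => w _.
    move: (disj w) (l0 w); case: (e x w); case: (e y w); case: (e z w) => //=; lra.
  have /andP[] := deg x; have /andP[] := deg y; have /andP[] := deg z; lra.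
have [x0 _] : exists x0 : T, true.
  case: (pickP (fun x : T => true)) => [x _|no]; first by exists x.
  by move: W0; rewrite big_pred0 //; lra.
have edge x : exists y, e x y.
  apply/existsP; rewrite -[[exists _, _]]negbK negb_exists; apply/negP => /forallP/= no.
  by have := deg x; rewrite big_pred0; [lra | move=> y; apply/negbTE].
have [y0 e0] := edge x0.
have nb x y w : e x y -> (e x w && e y w) = false.
  by move=> xy; apply/negbTE/negP => /andP[xw yw]; have := etf _ _ _ xy yw xw.
pose P := [set z | [exists b, e y0 b && e z b]].
pose Q := [set z | [exists a, e x0 a && e z a]].
have PQ z : (z \in P) = (z \notin Q).
  rewrite !inE; apply/idP/idP.
    move=> /existsP[b /andP[yb zb]]; apply/negP => /existsP[a /andP[xa za]].
    by apply: (nopent z a x0 y0 b) => //; rewrite esym.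
  move=> /negP nQ; have [w] := three z x0 y0; rewrite (nb _ _ w e0) orbF => /orP[]/andP[zw xw].
    by case: nQ; apply/existsP; exists w; rewrite xw.
  by apply/existsP; exists w; rewrite xw.
have nopp x y : e x y -> x \in P -> y \in P -> False.
  rewrite !PQ !inE !negb_exists => xy /forallP/= nx /forallP/= ny.
  have [w] := three x y x0; rewrite (nb _ _ w xy) /= => /orP[]/andP[w1 w2].
    by move: (nx w); rewrite w1 w2.
  by move: (ny w); rewrite w1 w2.
have noqq x y : e x y -> x \in Q -> y \in Q -> False.
  rewrite -[x \in Q]negbK -[y \in Q]negbK -!PQ !inE !negb_exists => xy /forallP/= nx /forallP/= ny.
  have [w] := three x y y0; rewrite (nb _ _ w xy) /= => /orP[]/andP[w1 w2].
    by move: (nx w); rewrite w1 w2.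
  by move: (ny w); rewrite w1 w2.
have bip x y : e x y -> (x \in P) = (y \notin P).
  move=> xy; move: (nopp _ _ xy) (noqq _ _ xy); rewrite -[x \in Q]negbK -[y \in Q]negbK -!PQ.
  by case: (x \in P); case: (y \in P) => //= h1 h2; [case: h1 | case: h2].
case: (leqP #|P| 4) => P4.
  exact: (bipartite_absurd esym reg cpos eps0 epsc r0 rc bip P4).
apply: (bipartite_absurd (P := ~: P) esym reg cpos eps0 epsc r0 rc).
  by move=> x y /bip; rewrite !inE => ->; rewrite negbK.
by rewrite -(leq_add2l 5) (leq_trans _ (_ : #|P| + #|~: P| <= 9)%N) ?leq_add2r // cardsC (leq_trans T8).
Qed.

(** * From measures to weightings *)

Section NeighborhoodDistance.

Variables (R : realFieldType) (T : finType) (e : rel T) (D : {set T}) (l : T -> R).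

Definition nbhd_dist (x y : T) : R := \sum_(z in D | e x z != e y z) l z.

Hypothesis l0 : forall x, 0 <= l x.

Lemma nbhd_distxx x : nbhd_dist x x = 0.
Proof. by rewrite /nbhd_dist big_pred0 // => z; rewrite eqxx andbF. Qed.

Lemma nbhd_distC x y : nbhd_dist x y = nbhd_dist y x.
Proof. by apply: eq_bigl => z; rewrite eq_sym. Qed.

Lemma nbhd_dist_triangle x y z : nbhd_dist x z <= nbhd_dist x y + nbhd_dist y z.
Proof.
rewrite /nbhd_dist ![\sum_(_ in _ | _) _]big_mkcondr -big_split /=; apply: ler_sum => t _.
have := l0 t; case: (e x t); case: (e y t); case: (e z t) => //=; lra.
Qed.

Lemma nbhd_dist_part (Z : pred T) x y : (forall z, Z z -> z \in D) ->
  \sum_(z | Z z && e x z) l z <= \sum_(z | Z z && e y z) l z + nbhd_dist x y.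
Proof.
move=> ZD; rewrite /nbhd_dist [X in X <= _]big_mkcond [X in _ <= X + _]big_mkcond.
rewrite [X in _ <= _ + X]big_mkcond -big_split /=; apply: ler_sum => z _.
case: (boolP (Z z)) => [/ZD->|_] /=; have := l0 z;
  case: (e x z); case: (e y z) => //=; try case: (z \in D) => //=; lra.
Qed.

End NeighborhoodDistance.

(* The clusters of a maximal separated set of neighborhoods form, up to a small
   error, a blow-up of a graph on at most eight vertices. *)
Lemma regular_measure_absurd (R : realFieldType) (T : finType) (e : rel T) (D : {set T})
    (l : T -> R) (rho c : R) :
  symmetric e ->
  (forall x y z, x \in D -> y \in D -> z \in D -> e x y -> e y z -> e x z -> False) ->
  (forall x, 0 <= l x) -> 1 - c / 12 <= \sum_(x in D) l x <= 1 ->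
  (forall x, x \in D -> rho - c / 12 <= \sum_(y in D | e x y) l y <= rho + c / 12) ->
  (forall S : {set T}, S \subset D ->
     {in S &, forall x y, x != y -> c / 192 / 100 <= nbhd_dist e D l x y} -> (#|S| <= 8)%N) ->
  0 < c -> 4 / 11 <= rho -> rho <= 3 / 8 - c -> False.
Proof.
move=> esym etf l0 /andP[W0 W1] deg sep8 cpos rho0 rhoc.
(* Clusters lighter than [m] are discarded. Over eight clusters the errors sum to at most
   [8 * (3 * th + m) = 824 * th], below [c / 12 = 1600 * th]; added to the given error [c / 12] they
   stay below [c / 6]. *)
pose th := c / 192 / 100; pose m := 100 * th.
have thE : c = 192 * (100 * th) by rewrite /th; field.
have th0 : 0 < th by rewrite /th; lra.
pose dist := nbhd_dist e D l.
pose sep (S : {set T}) := (S \subset D) &&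
  [forall x in S, forall y in S, (x != y) ==> (th <= dist x y)].
have [S Smax] : {S | maxset sep S}.
  apply: ex_maxset; exists set0; rewrite /sep sub0set.
  by apply/forall_inP => x; rewrite inE.
have [/andP[SD /forall_inP Ssep] _] := maxsetP Smax.
have S8 : (#|S| <= 8)%N.
  by apply: sep8 => // x y xS yS xy; move/forall_inP: (Ssep x xS) => /(_ y yS); rewrite xy.
have near x : x \in D -> exists i, (i \in S) && (dist x i < th).
  move=> xD; apply/existsP; rewrite -[[exists _, _]]negbK negb_exists; apply/negP => /forallP/= far.
  have xS : x \notin S by have := far x; rewrite /dist nbhd_distxx th0 andbT.
  have /(maxsetsup Smax)/(_ (subsetUr _ _)) E : sep (x |: S).
    rewrite /sep subUset sub1set xD SD /=.
    apply/forall_inP => a; rewrite !inE => aS; apply/forall_inP => b; rewrite !inE => bS.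
    apply/implyP; move: aS bS => /orP[/eqP->|aS] /orP[/eqP->|bS]; rewrite ?eqxx // => ab.
    - by have := far b; rewrite bS /= -leNgt.
    - by have := far a; rewrite aS /= -leNgt /dist nbhd_distC.
    by move/forall_inP: (Ssep a aS) => /(_ b bS); rewrite ab.
  by move: xS; rewrite -E !inE eqxx.
pose rep x := odflt x [pick i | (i \in S) && (dist x i < th)].
have repP x : x \in D -> (rep x \in S) /\ (dist x (rep x) < th).
  move=> xD; rewrite /rep; case: pickP => [i /andP[]|no] //=.
  by have [i] := near x xD; rewrite no.
pose C i : pred T := fun x => (x \in D) && (rep x == i).
have CD i x : C i x -> x \in D by case/andP.
have Cdist i x : C i x -> dist x i < th by case/andP => xD /eqP <-; case: (repP x xD).
pose L i := \sum_(x | C i x) l x.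
have L0 i : 0 <= L i by apply: sumr_ge0.
have part (P : pred T) : \sum_(x in D | P x) l x = \sum_(i in S) \sum_(x | C i x && P x) l x.
  rewrite (partition_big rep (mem S)) /=; last by move=> x /andP[/repP[]].
  by apply: eq_bigr => i _; apply: eq_bigl => x; rewrite /C andbAC.
have LS : \sum_(x in D) l x = \sum_(i in S) L i.
  have := part xpredT; under eq_bigl do rewrite andbT; move=> ->.
  by apply: eq_bigr => i _; apply: eq_bigl => x; rewrite andbT.
pose K i j := \sum_(y | C j y && e i y) l y.
pose K' i j := \sum_(y | C j y && ~~ e i y) l y.
have KK i j : K i j + K' i j = L j by rewrite /L (bigID (e i)).
have K0 i j : 0 <= K i j by apply: sumr_ge0.
have K'0 i j : 0 <= K' i j by apply: sumr_ge0.
have Kx i j x : C i x -> K i j - th <= K x j <= K i j + th.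
  move=> Cx; have h := Cdist _ _ Cx.
  have h1 := nbhd_dist_part e l0 x i (CD j).
  have h2 := nbhd_dist_part e l0 i x (CD j).
  rewrite nbhd_distC in h2; rewrite -/(dist _ _) -/(K x j) -/(K i j) in h1 h2.
  apply/andP; split; lra.
pose Q i j := \sum_(x | C i x) l x * K x j.
have Qsym i j : Q i j = Q j i.
  rewrite /Q /K; under eq_bigr do rewrite mulr_sumr.
  rewrite (exchange_big_dep (C j)) /=; last by move=> x y _ /andP[].
  apply: eq_bigr => y Cy; rewrite mulr_sumr; apply: eq_big => [x|x _]; last by rewrite mulrC.
  by rewrite Cy esym.
have QK i j : L i * (K i j - th) <= Q i j <= L i * (K i j + th).
  rewrite /L !mulr_suml; apply/andP; split; apply: ler_sum => x Cx; apply: ler_wpM2l => //;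
  by case/andP: (Kx i j x Cx).
have swap (Z : pred T) i : \sum_(y | Z y) l y * K y i =
    \sum_(x | C i x) l x * \sum_(y | Z y && e x y) l y.
  rewrite /K; under eq_bigr do rewrite mulr_sumr.
  rewrite (exchange_big_dep (C i)) /=; last by move=> y x _ /andP[].
  apply: eq_bigr => x Cx; rewrite mulr_sumr; apply: eq_big => [y|y _]; last by rewrite mulrC.
  by rewrite Cx esym.
(* Almost all of the cluster [i] treats [C j] like [i] does, while any two points of
   [C j] have almost the same neighbors in the cluster [i]. *)
have dich i j : m <= L i -> K i j <= 3 * th \/ K' i j <= 3 * th.
  move=> Lm; case: (leP (K i j) (3 * th)) => [|k1]; first by left.
  case: (leP (K' i j) (3 * th)) => [|k2]; first by right.
  exfalso.
  have [y /andP[Cy eiy] hy] : exists2 y, C j y && e i y & L i * (2 / 3) <= K y i.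
    case: (boolP [exists y, (C j y && e i y) && (L i * (2 / 3) <= K y i)]).
      by move=> /existsP[y /andP[h1 h2]]; exists y.
    rewrite negb_exists => /forallP/= no; exfalso.
    have h1 : \sum_(y | C j y && e i y) l y * K y i <= K i j * (L i * (2 / 3)).
      rewrite {2}/K mulr_suml; apply: ler_sum => y Cy; apply: ler_wpM2l => //.
      by have := no y; rewrite Cy /= -ltNge => /ltW.
    have h2 : L i * (K i j - th) <= \sum_(y | C j y && e i y) l y * K y i.
      have -> : \sum_(y | C j y && e i y) l y * K y i =
                \sum_(x | C i x) l x * \sum_(y | (C j y && e i y) && e x y) l y.
        exact: swap.
      rewrite /L mulr_suml; apply: ler_sum => x Cx; apply: ler_wpM2l => //.
      have ZD z : C j z && e i z -> z \in D by case/andP => /CD.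
      have := nbhd_dist_part e l0 i x ZD; rewrite nbhd_distC -/(dist _ _).
      rewrite (eq_bigl (fun y => C j y && e i y)) => [|y]; last by rewrite -andbA andbb.
      have := Cdist _ _ Cx; rewrite -/(K i j); lra.
    have Lp : 0 < L i by move: Lm; rewrite /m; lra.
    have : L i * (K i j * (2 / 3)) < L i * (K i j - th) by rewrite ltr_pM2l //; lra.
    move: h1 h2; move: (\sum_(y | _) _) => t; nra.
  have [y' /andP[Cy' eiy'] hy'] : exists2 y, C j y && ~~ e i y & K y i <= L i * (1 / 3).
    case: (boolP [exists y, (C j y && ~~ e i y) && (K y i <= L i * (1 / 3))]).
      by move=> /existsP[z /andP[h1 h2]]; exists z.
    rewrite negb_exists => /forallP/= no; exfalso.
    have h1 : K' i j * (L i * (1 / 3)) <= \sum_(y | C j y && ~~ e i y) l y * K y i.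
      rewrite {1}/K' mulr_suml; apply: ler_sum => z Cz; apply: ler_wpM2l => //.
      by have := no z; rewrite Cz /= -ltNge => /ltW.
    have h2 : \sum_(y | C j y && ~~ e i y) l y * K y i <= L i * th.
      have -> : \sum_(y | C j y && ~~ e i y) l y * K y i =
                \sum_(x | C i x) l x * \sum_(y | (C j y && ~~ e i y) && e x y) l y.
        exact: swap.
      rewrite /L mulr_suml; apply: ler_sum => x Cx; apply: ler_wpM2l => //.
      have ZD z : C j z && ~~ e i z -> z \in D by case/andP => /CD.
      have := nbhd_dist_part e l0 x i ZD; rewrite -/(dist _ _).
      rewrite [X in _ <= X + _]big_pred0 => [|z]; last by rewrite -andbA andNb andbF.
      have := Cdist _ _ Cx; lra.
    have Lp : 0 < L i by move: Lm; rewrite /m; lra.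
    have : L i * th < L i * (K' i j * (1 / 3)) by rewrite ltr_pM2l //; lra.
    move: h1 h2; move: (\sum_(y | _) _) => t; nra.
  (* Both [y] and [y'] lie within [th] of [j], so [K y i] and [K y' i] differ by less than [2 * th],
     yet they were chosen at least [L i / 3 >= m / 3] apart. *)
  have := Cdist _ _ Cy; have := Cdist _ _ Cy'.
  have := nbhd_dist_triangle e D l0 y j y'.
  have := nbhd_dist_part e l0 y y' (CD i).
  rewrite [nbhd_dist e D l j y']nbhd_distC -!/(dist _ _) -/(K y i) -/(K y' i).
  move: Lm; rewrite /m; lra.
(* Clusters are adjacent by majority of weighted pairs. This form is symmetric, unlike [K i j],
   which singles out the representative [i]. *)
pose H i j := L i * L j < 2 * Q i j.
have HK i j : m <= L i -> m <= L j -> H i j -> K' i j <= 3 * th.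
  move=> Li Lj; rewrite /H; case: (dich i j Li) => // k1.
  have /andP[_ q] := QK i j; move: Li Lj; rewrite /m => Li Lj h; exfalso.
  have : L i * (K i j + th) <= L i * (4 * th) by apply: ler_wpM2l => //; lra.
  have : L i * (100 * th) <= L i * L j by apply: ler_wpM2l.
  have : 0 < L i * th by apply: mulr_gt0 => //; lra.
  lra.
have HnK i j : m <= L i -> m <= L j -> ~~ H i j -> K i j <= 3 * th.
  move=> Li Lj; rewrite /H -leNgt; case: (dich i j Li) => // k1.
  have /andP[q _] := QK i j; move: Li Lj; rewrite /m => Li Lj h; exfalso.
  have : L i * (L j - 4 * th) <= L i * (K i j - th) by apply: ler_wpM2l => //; have := KK i j; lra.
  have : L i * (100 * th) <= L i * L j by apply: ler_wpM2l.
  have : 0 < L i * th by apply: mulr_gt0 => //; lra.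
  lra.
pose Hv := [set i in S | m <= L i].
have HvS i : i \in Hv -> i \in S by rewrite inE => /andP[].
have HvL i : i \in Hv -> m <= L i by rewrite inE => /andP[].
pose eH : rel {x in Hv} := fun i j => H (val i) (val j).
have S8' : #|S|%:R <= 8 :> R by rewrite ler_nat.
apply: (@near_regular_absurd R {x in Hv} eH (fun i => L (val i)) rho c (c / 6)) => //.
- rewrite card_sig; apply: leq_trans S8; apply: subset_leq_card.
  by apply/subsetP => i; apply: HvS.
- by move=> i j; rewrite /eH /H Qsym mulrC.
- move=> [i Hi] [j Hj] [k Hk]; rewrite /eH /= => ij jk ik.
  have Li := HvL _ Hi; have Lj := HvL _ Hj; have Lk := HvL _ Hk.
  have k1 := HK _ _ Li Lj ij; have k2 := HK _ _ Li Lk ik.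
  (* A point of [C j] adjacent to [i] has neighbors in [C k] only among the non-neighbors of [i].
     When [j] and [k] are both adjacent to [i] in [H], this makes [Q j k] too small for [H j k]. *)
  have : Q j k <= K' i j * L k + L j * K' i k.
    apply: le_trans (_ : \sum_(y | C j y) l y * (if e i y then K' i k else L k) <= _).
      apply: ler_sum => y Cy; apply: ler_wpM2l => //; case: ifP => eiy; last first.
        by apply: ler_sum_cond => // z /andP[].
      apply: ler_sum_cond => // z /andP[Cz yz]; rewrite Cz; apply/negP => iz.
      have iD := subsetP SD _ (HvS _ Hi).
      by have := etf _ _ _ iD (CD _ _ Cy) (CD _ _ Cz) eiy yz iz.
    rewrite (bigID (e i)) /= addrC; apply: lerD.
      by rewrite {2}/K' mulr_suml; apply: ler_sum => y /andP[_ /negbTE->].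
    apply: le_trans (_ : K i j * K' i k <= _).
      by rewrite /K mulr_suml; apply: ler_sum => y /andP[_ ->].
    by apply: ler_wpM2r => //; have := KK i j; have := K'0 i j; lra.
  have : K' i j * L k <= 3 * th * L k by apply: ler_wpM2r.
  have : L j * K' i k <= L j * (3 * th) by apply: ler_wpM2l.
  have : L j * (100 * th) <= L j * L k by apply: ler_wpM2l.
  have : (100 * th) * L k <= L j * L k by apply: ler_wpM2r.
  have : 0 < th * L k by apply: mulr_gt0 => //; move: Lk; rewrite /m; lra.
  have : 0 < L j * th by apply: mulr_gt0 => //; move: Lj; rewrite /m; lra.
  move: jk; rewrite /H; lra.
- have HvE (f : T -> R) : (forall i, 0 <= f i) -> \sum_(i : {x in Hv}) f (val i) <= \sum_(i in S) f i.
    by move=> f0; rewrite -big_sub; apply: ler_sum_cond.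
  split => [i||[i Hi]] //.
    rewrite -big_sub; apply/andP; split; last first.
      by apply: le_trans W1; rewrite LS; apply: ler_sum_cond.
    have : \sum_(i in S) L i <= \sum_(i in Hv) L i + \sum_(i in S) m.
      rewrite [\sum_(i in Hv) _]big_mkcond [\sum_(i in S) L i]big_mkcond [\sum_(i in S) m]big_mkcond.
      rewrite -big_split /=; apply: ler_sum => i _; rewrite inE; case: (i \in S) => /=; last by rewrite addr0.
      by case: (leP m (L i)) => h; [rewrite lerDl /m; lra | rewrite add0r ltW].
    rewrite -LS big_const iter_addr_0 -[_ *+ #|S|]mulr_natl.
    have : #|S|%:R * m <= 8 * m by apply: ler_wpM2r => //; rewrite /m; lra.
    move: (\sum_(i in Hv) _) (\sum_(x in D) _) W0 => a b; rewrite /m thE; lra.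
  have iS := HvS _ Hi; have iD := subsetP SD _ iS; have Li := HvL _ Hi.
  have := deg i iD; rewrite (_ : \sum_(y in D | e i y) l y = \sum_(j in S) K i j); last exact: part.
  have -> : \sum_(j | eH (exist _ i Hi) j) L (val j) = \sum_(j in S) (if (m <= L j) && H i j then L j else 0).
    rewrite /eH -(big_sub_cond Hv (fun j => H i j)) /= -big_mkcondr; apply: eq_bigl => j.
    by rewrite inE -andbA.
  have h1 : \sum_(j in S) (if (m <= L j) && H i j then L j else 0) <= \sum_(j in S) (K i j + (3 * th + m)).
    apply: ler_sum => j jS; case: ifP => [/andP[Lj ij]|_].
      have := HK _ _ Li Lj ij; have := KK i j; rewrite /m; lra.
    have := K0 i j; rewrite /m; lra.
  have h2 : \sum_(j in S) K i j <= \sum_(j in S) ((if (m <= L j) && H i j then L j else 0) + (3 * th + m)).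
    apply: ler_sum => j jS; have := KK i j; have := K'0 i j; case: (leP m (L j)) => [Lj|Lj] /=.
      case: (boolP (H i j)) => [_|ij]; first by rewrite /m; lra.
      have := HnK _ _ Li Lj ij; rewrite /m; lra.
    move: Lj; rewrite /m; lra.
  have h3 : \sum_(j in S) (3 * th + m) <= 8 * (3 * th + m).
    rewrite big_const iter_addr_0 -[_ *+ #|S|]mulr_natl; apply: ler_wpM2r => //; rewrite /m; lra.
  move: h1 h2; rewrite !(big_split _ _ _ _ (fun _ => 3 * th + m)) /=; move: h3.
  move: (\sum_(j in S) (3 * th + m)) (\sum_(j in S) K i j) (\sum_(j in S) (if _ then _ else _)) => a k b.
  rewrite thE => h3 h1 h2 /andP[h4 h5]; move: h3; rewrite /m => h3; apply/andP; split; lra.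
- by rewrite divr_ge0 //; lra.
lra.
Qed.

(** * Cores of families of large independent sets *)

Definition indep_set (V : finType) (e : rel V) (A : {set V}) : bool :=
  [forall x in A, forall y in A, ~~ e x y].

Lemma indep_setP (V : finType) (e : rel V) (A : {set V}) :
  reflect {in A &, forall x y, ~~ e x y} (indep_set e A).
Proof.
apply: (iffP forall_inP) => [h x y /h/forall_inP|h x xA]; first exact.
by apply/forall_inP => y; apply: h.
Qed.

(* Intersecting [C] with [J] costs at most [d] more than it adds to the union [U],
   because [(J :&: U) :|: C] is independent. *)
Lemma common_core (R : realFieldType) (V : finType) (e : rel V) (s : nat) (F : {set {set V}})
    (U0 : {set V}) (d t : R) :
  symmetric e -> (forall A, indep_set e A -> (#|A| <= s)%N) ->
  (forall J, J \in F -> [/\ indep_set e J, s%:R <= #|J|%:R + d & J \subset U0]) ->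
  F != set0 -> 0 <= d -> 0 < t ->
  exists C : {set V}, (forall J, J \in F -> #|C :\: J|%:R <= t) /\
    t * (2 * s%:R) <= t * (#|C|%:R + #|U0|%:R + 2 * d) + s%:R * d.
Proof.
move=> esym alpha FP /set0Pn[J0 J0F] d0 t0.
(* [C] and [U] are the intersection and the union of the members of [F] used so far. Each of the [k]
   steps costs at most [d] in [#|C| + #|U|] and removes more than [t] from [C], so [k * t <= s] and
   the total cost is at most [s * d / t]. *)
suff step m : forall (C U : {set V}) (k : nat), (#|C| < m)%N -> C \subset U -> U \subset U0 ->
    {in C & U, forall x y, ~~ e x y} ->
    2 * s%:R <= #|C|%:R + #|U|%:R + (k%:R + 2) * d -> #|C|%:R + k%:R * t <= s%:R ->
    exists C : {set V}, (forall J, J \in F -> #|C :\: J|%:R <= t) /\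
      t * (2 * s%:R) <= t * (#|C|%:R + #|U0|%:R + 2 * d) + s%:R * d.
  have [ind sJ JU] := FP _ J0F.
  apply: (step _ J0 J0 0%N (ltnSn _)) => //; first exact/indep_setP.
    lra.
  by rewrite mul0r addr0 ler_nat alpha.
elim: m => // m IH C U k Cm CU UU0 CUe inv1 inv2.
case: (boolP [exists J in F, t < #|C :\: J|%:R]) => [/exists_inP[J JF tJ]|]; last first.
  rewrite negb_exists_in => /forall_inP small; exists C; split=> [J /small|].
    by rewrite -leNgt.
  have UU : #|U|%:R <= #|U0|%:R :> R by rewrite ler_nat subset_leq_card.
  have C0 := ler0n R #|C|.
  have kd : k%:R * t * d <= s%:R * d by apply: ler_wpM2r => //; lra.
  have : t * (2 * s%:R) <= t * (#|C|%:R + #|U0|%:R + (k%:R + 2) * d).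
    by apply: ler_wpM2l; lra.
  nra.
have [/indep_setP Jind Js JU] := FP _ JF.
have cJ : #|C :&: J|%:R + #|C :\: J|%:R = #|C|%:R :> R by rewrite -natrD cardsID.
have JU' : #|J :&: U|%:R + #|J :\: U|%:R = #|J|%:R :> R by rewrite -natrD cardsID.
have UJ : #|U :|: J|%:R = #|U|%:R + #|J :\: U|%:R :> R.
  rewrite -natrD; congr _%:R; rewrite -(cardsID U) setUK; congr (_ + #|pred_of_set _|)%N.
  by rewrite setDUl setDv set0U.
have key : #|J :&: U|%:R + #|C :\: J|%:R <= s%:R :> R.
  have -> : #|J :&: U|%:R + #|C :\: J|%:R = #|(J :&: U) :|: C|%:R :> R.
    rewrite -natrD; congr _%:R; rewrite -[RHS](cardsID (J :&: U)) setUK.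
    congr (_ + #|pred_of_set _|)%N; rewrite setDUl setDv set0U; apply/setP => x; rewrite !inE.
    by case xC: (x \in C); rewrite ?andbF // (subsetP CU _ xC) !andbT.
  rewrite ler_nat alpha //; apply/indep_setP => x y; rewrite !inE.
  move=> /orP[/andP[xJ xU]|xC] /orP[/andP[yJ yU]|yC].
  - exact: Jind.
  - by rewrite esym CUe.
  - exact: CUe.
  by rewrite CUe // (subsetP CU).
apply: (IH (C :&: J) (U :|: J) k.+1).
- rewrite -ltnS (leq_ltn_trans _ Cm) //.
  have : 0 < #|C :\: J|%:R :> R by apply: lt_trans tJ.
  by rewrite -(cardsID J C) -addn1 leq_add2l ltr0n.
- by apply: subset_trans (subsetIl _ _) (subset_trans CU (subsetUl _ _)).
- by rewrite subUset UU0 JU.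
- move=> x y; rewrite !inE => /andP[xC xJ] /orP[yU|yJ]; first exact: CUe.
  exact: Jind.
- rewrite UJ -natr1; lra.
rewrite -natr1; lra.
Qed.

(** Bonferroni's inequality of order two for four sets. *)
Lemma card_setU4_ge (V : finType) (A B C D : {set V}) :
  (#|A| + #|B| + #|C| + #|D| <= #|A :|: B :|: C :|: D| + #|A :&: B| + #|A :&: C| + #|A :&: D| +
     #|B :&: C| + #|B :&: D| + #|C :&: D|)%N.
Proof.
have h1 := cardsUI A B; have h2 := cardsUI (A :|: B) C; have h3 := cardsUI (A :|: B :|: C) D.
have h4 : (#|(A :|: B) :&: C| <= #|A :&: C| + #|B :&: C|)%N.
  by rewrite setIUl; apply: leq_card_setU.
have h5 : (#|(A :|: B :|: C) :&: D| <= #|A :&: D| + #|B :&: D| + #|C :&: D|)%N.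
  rewrite !setIUl; apply: leq_trans (leq_card_setU _ _) _; rewrite leq_add2r; apply: leq_card_setU.
lia.
Qed.

(* The sets that are disjoint from a large independent set [A] share almost a common
   core [X A]; separated sets have almost disjoint cores, and a large independent set
   has room for at most three of these. *)
Lemma independent_weights_absurd (R : realFieldType) (V : finType) (e : rel V) (s : nat)
    (lam : {set V} -> R) (rho f : R) :
  let n : R := #|V|%:R in
  let th := 2 * f / 192 / 100 in let u := f * th / 16 in let b := f * u in
  symmetric e -> (forall A, indep_set e A -> (#|A| <= s)%N) ->
  0 < n -> 0 < f -> 22 * f * n <= 11 * s%:R - 4 * n -> 16 * f * n <= 3 * n - 8 * s%:R ->
  4 / 11 <= rho -> rho <= 3 / 8 - 2 * f ->
  (forall I, 0 <= lam I) -> (forall I, lam I != 0 -> indep_set e I) -> \sum_I lam I = 1 ->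
  (forall B, indep_set e B -> s%:R <= #|B|%:R + b * n ->
     rho - th / 8 <= \sum_(I : {set V} | [disjoint B & I]) lam I) ->
  (forall Y : {set V}, f * n <= #|Y|%:R ->
     \sum_I lam I * #|I :&: Y|%:R <= (rho + th / 16) * #|Y|%:R) ->
  \sum_I lam I * (s%:R - #|I|%:R) <= b ^+ 2 * n -> False.
Proof.
move=> n th u b esym alpha n0 f0 hx hy rho0 rhof lam0 lami lam1 la lb lp.
have f1 : f <= 1 / 176.
  rewrite leNgt; apply/negP => h.
  have : 1 / 176 * n < f * n by rewrite ltr_pM2r.
  lra.
have th0 : 0 < th by rewrite /th; lra.
have th1 : th <= f / 96 by rewrite /th; lra.
have u0 : 0 < u by rewrite /u divr_gt0 // mulr_gt0.
have u1 : u <= th / 100.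
  have : f * th <= 1 / 176 * th by rewrite ler_pM2r.
  by rewrite /u; lra.
have b0 : 0 < b by rewrite /b mulr_gt0.
have b1 : b <= u / 100.
  have : f * u <= 1 / 176 * u by rewrite ler_pM2r.
  by rewrite /b; lra.
have fn0 : 0 < f * n by rewrite mulr_gt0.
have un0 : 0 < u * n by rewrite mulr_gt0.
have bn0 : 0 < b * n by rewrite mulr_gt0.
pose D := [set I | indep_set e I && (s%:R <= #|I|%:R + b * n)].
pose disj : rel {set V} := fun A B => [disjoint A & B].
have disjC : symmetric disj by move=> A B; rewrite /disj disjoint_sym.
(* Markov's inequality for the deficit [s - #|I|], which exceeds [b * n] on independent sets outside
   [D]. *)
have bad : \sum_(I | I \notin D) lam I <= b.
  have : b * n * \sum_(I | I \notin D) lam I <= b ^+ 2 * n.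
    apply: le_trans lp; rewrite [X in _ <= X](bigID (mem D)) /=.
    apply: le_trans (_ : \sum_(I | I \notin D) lam I * (s%:R - #|I|%:R) <= _); last first.
      rewrite lerDr; apply: sumr_ge0 => I; rewrite inE => /andP[iI _].
      by apply: mulr_ge0 => //; rewrite subr_ge0 ler_nat alpha.
    rewrite mulr_sumr; apply: ler_sum => I; rewrite inE negb_and.
    have [-> _|/lami ->] := eqVneq (lam I) 0; first by rewrite mul0r mulr0.
    by rewrite /= -ltNge [b * n * _]mulrC => h; apply: ler_wpM2l => //; lra.
  by move=> h; rewrite -(ler_pM2l bn0); lra.
have DE (P : pred {set V}) : \sum_(I | P I) lam I <= \sum_(I in D | P I) lam I + b.
  rewrite (bigID (mem D)) /= (eq_bigl (fun I => (I \in D) && P I)) => [|I]; last by rewrite andbC.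
  by rewrite lerD2l; apply: le_trans bad; apply: ler_sum_cond => // I /andP[].
have Nlow A : A \in D -> rho - th / 8 - b <= \sum_(I in D | disj A I) lam I.
  rewrite inE => /andP[iA sA]; have := la A iA sA; have := DE (disj A).
  rewrite /disj; move: (\sum_(I | _) _) (\sum_(I in D | _) _) => a1 a2; lra.
have D1 (P : pred {set V}) : \sum_(I in D | P I) lam I <= 1.
  by rewrite -lam1; apply: ler_sum_cond.
(* Averaging over [Z]: every such [I] contains all but [u * n] points of [Z], while [lb] bounds the
   mean number of points of [Z] in a random [I]. *)
have up (P : pred {set V}) (Z : {set V}) : f * n <= #|Z|%:R ->
    (forall I, I \in D -> P I -> #|Z :\: I|%:R <= u * n) ->
    \sum_(I in D | P I) lam I <= rho + th / 8.
  move=> Z0 ZP; set m := \sum_(I in D | P I) lam I.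
  have Zp : 0 < #|Z|%:R :> R by apply: lt_le_trans Z0; rewrite mulr_gt0.
  have h1 : m * (#|Z|%:R - u * n) <= (rho + th / 16) * #|Z|%:R.
    apply: le_trans (lb Z Z0); rewrite /m mulr_suml [X in _ <= X](bigID (fun I => (I \in D) && P I)) /=.
    apply: le_trans (_ : \sum_(I in D | P I) lam I * #|I :&: Z|%:R <= _).
      apply: ler_sum => I /andP[ID PI]; apply: ler_wpM2l => //.
      have := ZP I ID PI; have := cardsID I Z; rewrite setIC => /(congr1 (fun k => k%:R : R)).
      rewrite natrD; lra.
    by rewrite lerDl; apply: sumr_ge0 => I _; apply: mulr_ge0.
  have h2 : m * (u * n) <= th / 16 * #|Z|%:R.
    apply: le_trans (_ : 1 * (u * n) <= _); first by apply: ler_wpM2r; [exact: ltW | exact: D1].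
    have -> : 1 * (u * n) = th / 16 * (f * n) by rewrite /u; field.
    by apply: ler_wpM2l => //; lra.
  rewrite -(ler_pM2r Zp); lra.
have cores A : exists X : {set V}, A \in D ->
    (forall I, I \in D -> disj A I -> #|X :\: I|%:R <= u * n) /\
    3 * s%:R - n - 2 * f * n <= #|X|%:R.
  case AD: (A \in D); last by exists set0.
  have [iA sA] : indep_set e A /\ s%:R <= #|A|%:R + b * n by move: AD; rewrite inE => /andP[].
  have FP J : J \in [set I in D | disj A I] ->
      [/\ indep_set e J, s%:R <= #|J|%:R + b * n & J \subset ~: A].
    rewrite !inE => /andP[/andP[iJ sJ] AJ]; split => //.
    by rewrite -disjoints_subset disjoint_sym.
  have F0 : [set I in D | disj A I] != set0.
    apply/negP => /eqP F0; have := Nlow A AD.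
    rewrite big_pred0 => [|I]; first lra.
    by have := in_set0 I; rewrite -F0 inE.
  (* The core is taken inside the complement of [A], with [d = b * n] and [t = u * n]. Since
     [b = f * u], the loss [s * d / t] is only [f * s]. *)
  have [X [XP Xc]] := common_core esym alpha FP F0 (ltW bn0) un0.
  exists X => _; split => [I ID AI|]; first by apply: XP; rewrite inE ID.
  have cA : #|A|%:R + #|~: A|%:R = n by rewrite -natrD cardsC.
  have hs : f * s%:R <= f * (3 / 8 * n) by rewrite ler_pM2l //; lra.
  have bf : b * n <= f / 100 * n by rewrite ler_pM2r //; lra.
  have : u * n * (2 * s%:R) <= u * n * (#|X|%:R + #|~: A|%:R + 2 * (b * n) + f * s%:R).
    by move: Xc; rewrite /b; lra.
  rewrite ler_pM2l //; lra.
have [X XP] := fin_all_exists cores.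
apply: (@regular_measure_absurd R {set V} disj D lam rho (2 * f)) => //.
- move=> A B C; rewrite !inE => /andP[_ sA] /andP[_ sB] /andP[_ sC] AB BC AC.
  have : (#|A| + #|B| + #|C| <= #|V|)%N.
    have h1 := cardsUI A B; have h2 := cardsUI (A :|: B) C.
    move: h1 h2; rewrite setIUl (disjoint_setI0 AB) (disjoint_setI0 AC) (disjoint_setI0 BC) setU0 cards0.
    by rewrite !addn0 => <- <-; apply: max_card.
  rewrite -(ler_nat R) !natrD -/n => h.
  have bf : b * n <= 1 / 100 * n by rewrite ler_pM2r //; lra.
  lra.
- apply/andP; split; last by rewrite -lam1; apply: ler_sum_cond.
  have := DE xpredT; rewrite lam1; under [X in _ <= X + _]eq_bigl do rewrite andbT.
  by move: (\sum_(x in D) _) => a; lra.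
- move=> A AD; apply/andP; split; first by have := Nlow A AD; lra.
  have [XA cX] := XP A AD; apply: le_trans (_ : rho + th / 8 <= _); last by lra.
  apply: (up _ (X A)) => //; apply: le_trans cX.
  have : f * n <= 1 / 176 * n by rewrite ler_pM2r.
  lra.
- move=> S SD Ssep.
  (* If the cores met in [f * n] points, [up] would bound the mass of the union of both
     neighborhoods by [rho + th / 8]. As each neighborhood has mass at least [rho - th / 8 - b],
     their distance would be at most [th / 2 + 2 * b < th]. *)
  have small A B : A \in S -> B \in S -> A != B -> #|X A :&: X B|%:R < f * n.
    move=> AS BS AB; rewrite ltNge; apply/negP => Z0.
    have AD := subsetP SD _ AS; have BD := subsetP SD _ BS.
    have [XA _] := XP A AD; have [XB _] := XP B BD.
    have h1 : \sum_(I in D | disj A I || disj B I) lam I <= rho + th / 8.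
      apply: (up _ (X A :&: X B)) => // I ID /orP[AI|BI].
        by apply: le_trans (XA I ID AI); rewrite ler_nat subset_leq_card // setSD // subsetIl.
      by apply: le_trans (XB I ID BI); rewrite ler_nat subset_leq_card // setSD // subsetIr.
    have h2 : 2 * (\sum_(I in D | disj A I || disj B I) lam I) =
        \sum_(I in D | disj A I) lam I + \sum_(I in D | disj B I) lam I + nbhd_dist disj D lam A B.
      rewrite /nbhd_dist ![\sum_(I in D | _) _]big_mkcondr -!big_split /= mulr_sumr.
      by apply: eq_bigr => I _; case: (disj A I); case: (disj B I) => /=; move: (lam I); clear => ?; lra.
    have := Nlow A AD; have := Nlow B BD; have := Ssep A B AS BS AB; rewrite -/th.
    move: h1 h2; move: (\sum_(I in D | disj A I || _) _) (\sum_(I in D | disj A I) _)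
      (\sum_(I in D | disj B I) _) (nbhd_dist _ _ _ _ _) => a1 a2 a3 a4; lra.
  (* Four cores of size about [3 * s - n], nearly contained in [I] and nearly disjoint, would force
     [4 * (3 * s - n) <= s] up to errors, against [22 * f * n <= 11 * s - 4 * n]. *)
  have three I : I \in D -> (#|[set A in S | disj A I]| <= 3)%N.
    move=> ID; rewrite leqNgt; apply/negP; rewrite cardE => four.
    have := enum_uniq [set A in S | disj A I].
    have mem A : A \in enum [set A in S | disj A I] -> A \in S /\ disj A I.
      by rewrite mem_enum inE => /andP[].
    move: (enum _) four mem => [|A1 [|A2 [|A3 [|A4 q]]]] //= _ mem.
    rewrite !inE !negb_or => /andP[/and4P[d12 d13 d14 _] /andP[/and3P[d23 d24 _] /andP[/andP[d34 _] _]]].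
    have [S1 I1] := mem A1 (mem_head _ _).
    have [S2 I2] : A2 \in S /\ disj A2 I by apply: mem; rewrite !inE eqxx ?orbT.
    have [S3 I3] : A3 \in S /\ disj A3 I by apply: mem; rewrite !inE eqxx ?orbT.
    have [S4 I4] : A4 \in S /\ disj A4 I by apply: mem; rewrite !inE eqxx ?orbT.
    have XI A : A \in S -> disj A I -> 3 * s%:R - n - 2 * f * n - u * n <= #|I :&: X A|%:R.
      move=> AS AI; have [XA cX] := XP A (subsetP SD _ AS).
      have := XA I ID AI; have := cardsID I (X A); rewrite setIC => /(congr1 (fun k => k%:R : R)).
      rewrite natrD; lra.
    have XX A B : A \in S -> B \in S -> A != B -> #|(I :&: X A) :&: (I :&: X B)|%:R < f * n.
      move=> AS BS AB; apply: le_lt_trans (small A B AS BS AB).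
      by rewrite ler_nat subset_leq_card // setISS // subsetIr.
    have := card_setU4_ge (I :&: X A1) (I :&: X A2) (I :&: X A3) (I :&: X A4).
    have : (#|(I :&: X A1) :|: (I :&: X A2) :|: (I :&: X A3) :|: (I :&: X A4)| <= s)%N.
      apply: leq_trans (_ : #|I| <= _)%N; first by rewrite subset_leq_card // !subUset !subsetIl.
      by apply: alpha; move: ID; rewrite inE => /andP[].
    rewrite -!(ler_nat R) !natrD.
    have := XI _ S1 I1; have := XI _ S2 I2; have := XI _ S3 I3; have := XI _ S4 I4.
    have := XX _ _ S1 S2 d12; have := XX _ _ S1 S3 d13; have := XX _ _ S1 S4 d14.
    have := XX _ _ S2 S3 d23; have := XX _ _ S2 S4 d24; have := XX _ _ S3 S4 d34.
    have uf : u * n <= f / 100 * n by rewrite ler_pM2r //; lra.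
      clear -hx uf fn0; lra.
  (* Nine separated sets would each have degree about [rho], while a random [I] is disjoint from at
     most three of them; but [9 * rho >= 36 / 11 > 3]. *)
  rewrite leqNgt; apply/negP => S9.
  have : \sum_(A in S) \sum_(I in D | disj A I) lam I <= 3.
    rewrite (exchange_big_dep (mem D)) /=; last by move=> A I _ /andP[].
    apply: le_trans (_ : \sum_(I in D) lam I * 3 <= _).
      apply: ler_sum => I ID; rewrite sumr_const -[lam I *+ _]mulr_natr; apply: ler_wpM2l => //.
      rewrite ler_nat; apply: leq_trans (three I ID); apply: subset_leq_card.
      by apply/subsetP => A; rewrite unfold_in => /andP[AS /andP[_ AI]]; rewrite inE AS.
    rewrite -mulr_suml; have : \sum_(I in D) lam I <= 1 by rewrite -lam1; apply: ler_sum_cond.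
    by move: (\sum_(I in D) _) => a; lra.
  have : \sum_(A in S) (rho - th / 8 - b) <= \sum_(A in S) \sum_(I in D | disj A I) lam I.
    by apply: ler_sum => A AS; apply: Nlow; apply: (subsetP SD).
  rewrite sumr_const -[_ *+ #|S|]mulr_natl.
  have : 9 * (rho - th / 8 - b) <= #|S|%:R * (rho - th / 8 - b).
    by apply: ler_wpM2r; [lra | rewrite ler_nat].
  move: (#|S|%:R * _) (\sum_(A in S) _) => a1 a2; lra.
- lra.
Qed.

(** * Blow-ups *)

Definition admissible (n s : nat) (E : {set {set 'I_n}}) : bool :=
  [&& simple_graph E, triangle_free E
    & [forall A : {set 'I_n}, independent E A ==> (#|A| <= s)%N]].

Lemma adj_sym (V : finType) (E : {set {set V}}) : symmetric (adj E).
Proof. by move=> x y; rewrite /adj setUC. Qed.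

Lemma triangle_free_adj (V : finType) (E : {set {set V}}) :
  triangle_free E -> triangle_free_rel (adj E).
Proof.
move=> /negP tf x y z xy yz xz; apply: tf.
by apply/existsP; exists x; apply/existsP; exists y; apply/existsP; exists z; rewrite xy yz xz.
Qed.

Lemma eq_set2 (V : finType) (a b x y : V) :
  ([set a; b] == [set x; y]) = ((x == a) && (y == b)) || ((x == b) && (y == a)).
Proof.
apply/eqP/orP => [E|[/andP[/eqP-> /eqP->]|/andP[/eqP-> /eqP->]]] //; last by rewrite setUC.
have /set2P xab : x \in [set a; b] by rewrite E set21.
have /set2P yab : y \in [set a; b] by rewrite E set22.
have /set2P axy : a \in [set x; y] by rewrite -E set21.
have /set2P bxy : b \in [set x; y] by rewrite -E set22.
case: xab axy bxy => -> axy bxy; [left | right]; rewrite eqxx /=; apply/eqP.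
  by case: yab bxy => -> // -[].
by case: yab axy => -> // -[].
Qed.

Lemma sum_adj (V : finType) (E : {set {set V}}) : simple_graph E ->
  (\sum_x \sum_y adj E x y = 2 * #|E|)%N.
Proof.
move=> /forall_inP simple.
rewrite pair_big /= (eq_bigr (fun p : V * V => \sum_(A in E) (A == [set p.1; p.2])))%N; last first.
  move=> [x y] _ /=; rewrite /adj; case: (boolP (_ \in E)) => xyE.
    by rewrite (bigD1 _ xyE) eqxx big1 //= => A /andP[_ /negbTE->].
  by rewrite big1 // => A AE; case: eqP => // E'; rewrite -E' AE in xyE.
rewrite exchange_big /= mulnC -sum_nat_const; apply: eq_bigr => A AE.
have /cards2P[a [b [ab ->]]] := simple A AE.
rewrite (bigD1 (a, b)) //= (bigD1 (b, a)) /=; last by rewrite xpair_eqE eq_sym (negbTE ab).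
rewrite !eq_set2 !eqxx orbT big1 // => -[x y] /andP[/= n1 n2].
by rewrite eq_set2; move: n1 n2; rewrite !xpair_eqE => /negbTE-> /negbTE->.
Qed.

(** Positivity excludes the empty family, whose maximum is [0] by convention. *)
Lemma ex_tf_attained (n s : nat) : (0 < ex_tf n s)%N ->
  exists2 E : {set {set 'I_n}}, admissible s E & #|E| = ex_tf n s.
Proof.
move=> ex0; have [E0 E0P] : exists E, admissible (n := n) s E.
  apply/existsP; apply: contraLR ex0; rewrite negb_exists => /forallP no.
  by rewrite /ex_tf big_pred0 // => E; apply/negbTE/no.
have := eq_bigmax_cond (fun E : {set {set 'I_n}} => #|E|) (A := admissible s).
case=> [|E EP E']; last by exists E => //; rewrite -E'.
by apply/card_gt0P; exists E0.
Qed.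

Lemma admissible_le_ex_tf (n s : nat) (E : {set {set 'I_n}}) :
  admissible s E -> (#|E| <= ex_tf n s)%N.
Proof. by move=> EP; apply: (leq_bigmax_cond (P := admissible s)). Qed.

Lemma rel_le_ex_tf (V : finType) (e : rel V) (s : nat) :
  symmetric e -> triangle_free_rel e -> (forall A, indep_set e A -> (#|A| <= s)%N) ->
  (\sum_x \sum_y e x y <= 2 * ex_tf #|V| s)%N.
Proof.
move=> esym etf alpha; pose n := #|V|; pose v (i : 'I_n) : V := enum_val i.
pose E := [set A : {set 'I_n} | [exists x, exists y, e (v x) (v y) && (A == [set x; y])]].
have adjE x y : adj E x y = e (v x) (v y).
  rewrite /adj inE; apply/existsP/idP => [[a /existsP[b /andP[ab /eqP E']]]|xy]; last first.
    by exists x; apply/existsP; exists y; rewrite xy eqxx.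
  by move/eqP: E'; rewrite eq_set2 => /orP[]/andP[/eqP E1 /eqP E2]; move: ab; rewrite E1 E2 // esym.
have sE : simple_graph E.
  apply/forall_inP => A; rewrite inE => /existsP[x /existsP[y /andP[xy /eqP->]]].
  rewrite cards2 eqSS eqb1; apply/eqP => E'; move: xy; rewrite E' => xx.
  by have := etf _ _ _ xx xx xx.
have EP : admissible s E.
  apply/and3P; split=> //.
    apply/negP => /existsP[x /existsP[y /existsP[z /and3P[]]]]; rewrite !adjE => xy yz xz.
    exact: etf xy yz xz.
  apply/forallP => A; apply/implyP => /forall_inP indA.
  rewrite -(card_imset _ enum_val_inj) alpha //.
  apply/indep_setP => _ _ /imsetP[x xA ->] /imsetP[y yA ->].
  by move/forall_inP: (indA x xA) => /(_ y yA); rewrite adjE.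
apply: leq_trans (_ : 2 * #|E| <= _)%N; last by rewrite leq_mul2l admissible_le_ex_tf.
rewrite -sum_adj //; apply: eq_leq.
rewrite (reindex v) /=; last exact: onW_bij (enum_val_bij V).
apply: eq_bigr => x _; rewrite (reindex v) /=; last exact: onW_bij (enum_val_bij V).
by apply: eq_bigr => y _; rewrite adjE.
Qed.

(** Each [x] becomes a class of [w x] vertices. An independent set of the blow-up projects to an
    independent set of [T] and is contained in the union of the classes over its projection. *)
Lemma blowup_le_ex_tf (T : finType) (e : rel T) (w : T -> nat) (s : nat) :
  symmetric e -> triangle_free_rel e ->
  (forall A, indep_set e A -> (\sum_(x in A) w x <= s)%N) ->
  (\sum_x \sum_y e x y * (w x * w y) <= 2 * ex_tf (\sum_x w x) s)%N.
Proof.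
move=> esym etf alpha; pose V := {x : T & 'I_(w x)}.
pose eV : rel V := fun u v => e (tag u) (tag v).
have sumV (P : pred T) (F : T -> nat) :
    (\sum_(u : V | P (tag u)) F (tag u) = \sum_(x | P x) w x * F x)%N.
  rewrite (eq_bigl (fun u : V => P (tag u) && true)) => [|u]; last by rewrite andbT.
  rewrite -(sig_big_dep (J := fun x => 'I_(w x)) P (fun _ => xpredT) (fun x _ => F x)).
  by apply: eq_bigr => x _; rewrite sum_nat_const card_ord.
have cV : #|{: V}| = (\sum_x w x)%N.
  rewrite -sum1_card; have := sumV xpredT (fun=> 1%N) => /= ->.
  by apply: eq_bigr => x _; rewrite muln1.
rewrite -cV; apply: leq_trans (_ : \sum_(u : V) \sum_(v : V) eV u v <= _)%N.
  rewrite [X in (_ <= X)%N](eq_bigr (fun u : V => \sum_y w y * e (tag u) y))%N; last first.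
    by move=> u _; apply: (sumV xpredT (fun y => e (tag u) y)).
  rewrite (sumV xpredT (fun x => \sum_y w y * e x y))%N; apply: eq_leq.
  by apply: eq_bigr => x _; rewrite big_distrr; apply: eq_bigr => y _ /=; rewrite mulnC -mulnA.
apply: rel_le_ex_tf => [u v|u v z|A indA]; [exact: esym | exact: etf |].
pose B := [set tag u | u in A].
apply: leq_trans (alpha B _); last first.
  apply/indep_setP => _ _ /imsetP[u uA ->] /imsetP[v vA ->].
  by have /indep_setP/(_ _ _ uA vA) := indA.
rewrite -sum1_card; apply: leq_trans (_ : \sum_(u : V | tag u \in B) 1 <= _)%N.
  rewrite [X in (X <= _)%N]big_mkcond [X in (_ <= X)%N]big_mkcond; apply: leq_sum => u _.
  by case: ifP => // uA; rewrite imset_f.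
by rewrite (sumV (mem B) (fun=> 1%N)); apply: leq_sum => x _; rewrite muln1.
Qed.

(** Neighborhoods in a triangle-free graph are independent, so all degrees are at most [s]. *)
Lemma ex_tf_degree_bound (n s : nat) : (2 * ex_tf n s <= n * s)%N.
Proof.
case: (posnP (ex_tf n s)) => [->|/ex_tf_attained[E /and3P[sE tE /forallP aE] <-]].
  by rewrite muln0.
rewrite -sum_adj //; have -> : (n * s = \sum_(x : 'I_n) s)%N by rewrite sum_nat_const card_ord.
apply: leq_sum => x _.
rewrite (eq_bigr (fun y => if y \in [set y | adj E x y] then 1 else 0)%N) => [|y _]; last first.
  by rewrite inE; case: (adj _ _ _).
rewrite -big_mkcond sum1_card; apply: (implyP (aE _)).
apply/forall_inP => y; rewrite inE => xy; apply/forall_inP => z; rewrite inE => xz.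
by apply/negP => yz; apply: (triangle_free_adj tE xy yz xz).
Qed.

(** * Theorem of the alternative *)

Lemma seq_max (R : realFieldType) (a : R) (A : seq R) :
  exists2 m, m \in a :: A & forall b, b \in a :: A -> b <= m.
Proof.
elim: A a => [|a' A IH] a; first by exists a => [|b]; rewrite inE // => /eqP->.
have [m mA mP] := IH a'; case: (leP a m) => am.
  exists m => [|b]; rewrite inE ?mA ?orbT // => /orP[/eqP->|/mP] //.
exists a => [|b]; rewrite inE ?eqxx // => /orP[/eqP->|/mP] // bm.
exact: le_trans bm (ltW am).
Qed.

Lemma seq_between (R : realFieldType) (A B : seq R) :
  (forall a b, a \in A -> b \in B -> a < b) ->
  exists t, (forall a, a \in A -> a < t) /\ (forall b, b \in B -> t < b).
Proof.
case: A => [|a A] AB.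
  case: B AB => [|b B] _; first by exists 0.
  have [m mB mP] := seq_max (- b) [seq - x | x <- B]; exists (- m - 1); split => // x xB.
  have : - x <= m by apply: mP; rewrite -map_cons map_f.
  lra.
have [m mA mP] := seq_max a A.
case: B AB => [|b B] AB.
  by exists (m + 1); split => // x /mP; lra.
have [k kB kP] := seq_max (- b) [seq - x | x <- B].
move: kB; rewrite -map_cons => /mapP[k' kB k'E].
have := AB m k' mA kB; exists ((m + k') / 2); split => [x /mP|x xB]; first lra.
have : - x <= k by apply: kP; rewrite -map_cons map_f.
lra.
Qed.

(** Zero is not adjoined: every element combines at least one member of [L] with positive
    coefficients, so the resulting measure can be normalized. *)
Inductive pos_cone (R : realFieldType) (I : finType) (L : seq {ffun I -> R^o}) :
    {ffun I -> R^o} -> Prop :=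
| pos_cone_mem v : v \in L -> pos_cone L v
| pos_cone_add u v : pos_cone L u -> pos_cone L v -> pos_cone L (u + v)
| pos_cone_scale a u : 0 < a -> pos_cone L u -> pos_cone L (a *: u).

(* Fourier-Motzkin elimination of the last coordinate. *)
Lemma cone_alternative (R : realFieldType) (I : finType) (rs : seq I) (L : seq {ffun I -> R^o}) :
  uniq rs ->
  (exists y : I -> R, (forall i, 0 <= y i) /\
     forall v, v \in L -> \sum_(i <- rs) y i * v i < 0) \/
  (exists2 u, pos_cone L u & forall i, i \in rs -> 0 <= u i).
Proof.
elim: rs L => [|r rs IH] L /=.
  case: L => [|v L] _; first by left; exists (fun=> 0).
  by right; exists v => //; apply: pos_cone_mem; rewrite mem_head.
move=> /andP[rrs us].
pose Lp := [seq v : {ffun I -> R^o} <- L | 0 < (v r : R)].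
pose Ln := [seq w : {ffun I -> R^o} <- L | (w r : R) < 0].
(* The second list holds positive combinations of two members of [L] in which coordinate [r]
   cancels. *)
pose L' := [seq v : {ffun I -> R^o} <- L | 0 <= (v r : R)] ++ [seq (v r : R) *: w - (w r : R) *: v | v : {ffun I -> R^o} <- Lp, w : {ffun I -> R^o} <- Ln].
have [[y [y0 yP]]|[u uc up]] := IH L' us; last first.
  right; exists u => [|i].
    elim: uc => {u up} [v|u v _ hu _ hv|a u a0 _ hu].
    - rewrite mem_cat => /orP[|/allpairsP[[v' w] [/=]]].
        by rewrite mem_filter => /andP[_ vL]; apply: pos_cone_mem.
      rewrite !mem_filter => /andP[v0 vL] /andP[w0 wL] ->; rewrite -scaleNr.
      by apply: pos_cone_add; apply: pos_cone_scale; rewrite ?oppr_gt0 //; apply: pos_cone_mem.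
    - exact: pos_cone_add.
    exact: pos_cone_scale.
  rewrite inE => /orP[/eqP->|/up] //.
  elim: uc => {u up i} [v|u v _ hu _ hv|a u a0 _ hu].
  - rewrite mem_cat => /orP[|/allpairsP[[v' w] [/=]]].
      by rewrite mem_filter => /andP[].
    by move=> _ _ ->; rewrite !ffunE /GRing.scale /= mulrC subrr.
  - by rewrite !ffunE addr_ge0.
  by rewrite !ffunE; apply: mulr_ge0 => //; apply: ltW.
left; pose h (v : {ffun I -> R^o}) : R := \sum_(i <- rs) y i * v i.
have hpos (v : {ffun I -> R^o}) : v \in L -> 0 <= v r -> h v < 0.
  by move=> vL v0; apply: yP; rewrite mem_cat mem_filter v0 vL.
have hpair (v w : {ffun I -> R^o}) : v \in L -> w \in L -> 0 < v r -> w r < 0 -> v r * h w < w r * h v.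
  move=> vL wL v0 w0.
  have : h (v r *: w - w r *: v) < 0.
    apply: yP; rewrite mem_cat; apply/orP; right; apply/allpairsP; exists (v, w).
    by rewrite !mem_filter v0 w0 vL wL.
  have -> : h (v r *: w - w r *: v) = v r * h w - w r * h v.
    rewrite /h !mulr_sumr -sumrB; apply: eq_bigr => i _; rewrite !ffunE /= /GRing.scale /=; ring.
  by rewrite subr_lt0.
(* The multiplier [t] at [r] must lie above [A] and below [B]: vectors with negative entry at [r]
   give lower bounds, those with positive entry upper bounds. The [0] in [A] makes [t]
   nonnegative. *)
pose A := 0 :: [seq h w / - (w r : R) | w : {ffun I -> R^o} <- Ln].
pose B := [seq - h v / (v r : R) | v : {ffun I -> R^o} <- Lp].
have AB a b : a \in A -> b \in B -> a < b.
  rewrite inE => aA /mapP[v]; rewrite mem_filter => /andP[v0 vL] ->.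
  move: aA => /orP[/eqP->|/mapP[w]].
    by rewrite divr_gt0 // oppr_gt0 hpos // ltW.
  rewrite mem_filter => /andP[w0 wL] ->.
  rewrite ltr_pdivrMr ?oppr_gt0 // mulrAC ltr_pdivlMr //.
  by have := hpair v w vL wL v0 w0; lra.
have [t [tA tB]] := seq_between AB.
exists (fun i => if i == r then t else y i); split=> [i|v vL].
  by case: eqP => // _; apply/ltW/tA; rewrite mem_head.
rewrite big_cons eqxx (eq_big_seq (fun i => y i * v i)) => [|i irs]; last first.
  by case: eqP => // E; move: rrs; rewrite -E irs.
rewrite -/(h v); case: (ltrgt0P (v r)) => v0.
- have : t < - h v / v r by apply: tB; apply/mapP; exists v; rewrite ?mem_filter ?v0.
  by rewrite ltr_pdivlMr //; lra.
- have : h v / - v r < t by apply: tA; rewrite inE; apply/orP; right; apply/mapP; exists v; rewrite ?mem_filter ?v0.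
  by rewrite ltr_pdivrMr ?oppr_gt0 //; lra.
by rewrite v0 mulr0 add0r hpos // v0.
Qed.

(** Ville's theorem, from the cone of the columns of [M]: an element of this cone combines columns
    with positive total coefficient, and dividing by that total gives a probability vector. *)
Lemma ville_alternative (R : realFieldType) (I J : finType) (M : I -> J -> R) :
  (exists g : I -> R, (forall i, 0 <= g i) /\ forall j, \sum_i g i * M i j < 0) \/
  (exists lam : J -> R, [/\ forall j, 0 <= lam j, \sum_j lam j = 1 &
     forall i, 0 <= \sum_j lam j * M i j]).
Proof.
pose col j : {ffun I -> R^o} := [ffun i => M i j].
have [[g [g0 gP]]|[u uc u0]] := cone_alternative [seq col j | j <- enum J] (index_enum_uniq I).
  left; exists g; split=> // j; have := gP (col j); rewrite map_f ?mem_enum // => /(_ isT).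
  by under eq_bigr do rewrite ffunE.
right.
have [lam [lam0 lamp lamE]] : exists lam : J -> R, [/\ forall j, 0 <= lam j, 0 < \sum_j lam j &
    forall i, u i = \sum_j lam j * M i j].
  elim: uc => {u u0} [v /mapP[j _ ->]|u v _ [l1 [p1 s1 e1]] _ [l2 [p2 s2 e2]]|a u a0 _ [l1 [p1 s1 e1]]].
  - exists (fun k => (k == j)%:R); split=> [k||i]; first exact: ler0n.
      by rewrite (bigD1 j) //= eqxx big1 ?addr0 // => k /negbTE->.
    rewrite ffunE (bigD1 j) //= eqxx mul1r big1 ?addr0 // => k /negbTE->; exact: mul0r.
  - exists (fun j => l1 j + l2 j); split=> [j||i]; first exact: addr_ge0.
      by rewrite big_split addr_gt0.
    by rewrite !ffunE e1 e2 -big_split; apply: eq_bigr => j _; rewrite mulrDl.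
  exists (fun j => a * l1 j); split=> [j||i]; first by apply: mulr_ge0 => //; apply: ltW.
    by rewrite -mulr_sumr mulr_gt0.
  by rewrite !ffunE e1 /GRing.scale /= mulr_sumr; apply: eq_bigr => j _; rewrite mulrA.
set s := \sum_j lam j in lamp; exists (fun j => lam j / s); split=> [j||i].
- by apply: divr_ge0 => //; apply: ltW.
- by rewrite -mulr_suml divff ?gt_eqF.
rewrite (eq_bigr (fun j => (lam j * M i j) / s)) => [|j _]; last by rewrite mulrAC.
by rewrite -mulr_suml -lamE; apply: divr_ge0; [apply: u0; rewrite mem_index_enum | apply: ltW].
Qed.

(** * Perturbation of a near-extremal graph *)

Definition turan_form (n s : rat) : rat := 6 * n ^+ 2 - 32 * (n * s) + 44 * s ^+ 2.

(** With [G = F + tau], this makes a graph of excess [F] optimal up to [tau] among all pairs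
    [(n, s)] in the range at once. *)
Definition ex_bound (G : rat) : Prop := forall n s : nat, (4 * n <= 11 * s)%N -> (8 * s <= 3 * n)%N ->
  (ex_tf n s)%:R <= turan_form n%:R s%:R + G * n%:R ^+ 2.

Lemma common_denominator (T : finType) (W : T -> rat) : (forall t, 0 <= W t) ->
  exists (d : nat) (w : T -> nat), (0 < d)%N /\ forall t, (w t)%:R = d%:R * W t.
Proof.
move=> W0; pose q t := `|denq (W t)|%N; exists (\prod_t q t)%N.
exists (fun t => `|numq (W t)| * \prod_(u | u != t) q u)%N; split=> [|t].
  by rewrite prodn_gt0 // => t; rewrite /q absz_gt0 denq_neq0.
have -> : (\prod_t q t = q t * \prod_(u | u != t) q u)%N by rewrite (bigD1 t).
rewrite !natrM mulrAC; congr (_ * _).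
have numE : (`|numq (W t)|%N)%:R = (numq (W t))%:~R :> rat.
  by rewrite -[in RHS](@gez0_abs (numq (W t))) // numq_ge0.
have denE : (q t)%:R = (denq (W t))%:~R :> rat.
  by rewrite -[in RHS](@gez0_abs (denq (W t))) // ltW // denq_gt0.
by rewrite numE denE -[X in _ * X]divq_num_den mulrCA divff ?mulr1 // intr_eq0 denq_neq0.
Qed.

(** Both sides are homogeneous of degree two, so rational weights reduce to integral ones by
    clearing denominators. *)
Lemma blowup_le_bound (G : rat) (T : finType) (e : rel T) (W : T -> rat) (s' : rat) :
  ex_bound G -> symmetric e -> triangle_free_rel e -> (forall t, 0 <= W t) ->
  (forall A, indep_set e A -> \sum_(x in A) W x <= s') ->
  let n' := \sum_x W x in 4 * n' <= 11 * s' -> 8 * s' <= 3 * n' ->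
  \sum_x \sum_y (e x y)%:R * (W x * W y) <= 2 * (turan_form n' s' + G * n' ^+ 2).
Proof.
move=> bound esym etf W0 alpha n' lo hi.
have s0 : 0 <= s' by have := alpha set0; rewrite big_set0; apply; apply/indep_setP => x y; rewrite inE.
(* [None] carries [s'], so that one denominator serves the weights and the independence bound. *)
pose W' (t : option T) := if t is Some x then W x else s'.
have [d [w [d0 wE]]] : exists (d : nat) (w : option T -> nat), (0 < d)%N /\ forall t, (w t)%:R = d%:R * W' t.
  by apply: common_denominator => -[x|] /=.
pose v x := w (Some x); pose s := w None.
have vE x : (v x)%:R = d%:R * W x := wE (Some x).
have sE : s%:R = d%:R * s' := wE None.
have nE : (\sum_x v x)%N%:R = d%:R * n'.
  by rewrite natr_sum mulr_sumr; apply: eq_bigr => x _.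
have dp : 0 < d%:R :> rat by rewrite ltr0n.
have lo' : (4 * (\sum_x v x) <= 11 * s)%N.
  rewrite -(ler_nat rat) !natrM nE sE.
  by have := ler_wpM2l (ltW dp) lo; lra.
have hi' : (8 * s <= 3 * (\sum_x v x))%N.
  rewrite -(ler_nat rat) !natrM nE sE.
  by have := ler_wpM2l (ltW dp) hi; lra.
have ind A : indep_set e A -> (\sum_(x in A) v x <= s)%N.
  move=> /alpha; rewrite -(ler_nat rat) natr_sum sE.
  by under eq_bigr do rewrite vE; rewrite -mulr_sumr ler_pM2l.
have := blowup_le_ex_tf esym etf ind; have := bound _ _ lo' hi'.
rewrite nE sE -(ler_nat rat) natrM natr_sum => h1 h2.
have d2 : 0 < d%:R ^+ 2 :> rat by rewrite exprn_gt0.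
rewrite -(ler_pM2l d2).
have -> : d%:R ^+ 2 * \sum_x \sum_y (e x y)%:R * (W x * W y) =
    \sum_x (\sum_y e x y * (v x * v y))%N%:R.
  rewrite mulr_sumr; apply: eq_bigr => x _; rewrite mulr_sumr natr_sum; apply: eq_bigr => y _.
  by rewrite !natrM !vE; ring.
by apply: le_trans h2 _; move: h1; rewrite /turan_form; lra.
Qed.

(** * Weighted graphs obtained by adding vertices and removing weight *)

Section Perturbation.

Variables (V : finType) (e : rel V) (c r : {set V} -> rat).

Definition removed (v : V) : rat := \sum_(Y : {set V} | v \in Y) r Y / #|Y|%:R.

(** Each set [B] yields a new vertex, isolated unless [B] is independent. New vertices are pairwise
    non-adjacent, so no triangle arises. *)
Definition perturbed_rel : rel (V + {set V}) := fun x y =>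
  match x, y with
  | inl u, inl v => e u v
  | inl u, inr B => (u \in B) && indep_set e B
  | inr B, inl u => (u \in B) && indep_set e B
  | inr _, inr _ => false
  end.

Definition perturbed_weight (x : V + {set V}) : rat :=
  match x with inl v => 1 - removed v | inr B => c B end.

Lemma perturbed_rel_sym : symmetric e -> symmetric perturbed_rel.
Proof. by move=> esym [u|B] [v|C] //=. Qed.

Lemma perturbed_rel_triangle_free : triangle_free_rel e -> triangle_free_rel perturbed_rel.
Proof.
move=> etf [u|A] [v|B] [w|C] //=; first exact: etf.
- by move=> uv /andP[vC /indep_setP indC] /andP[uC _]; have := indC _ _ uC vC; rewrite uv.
- by move=> /andP[uB /indep_setP indB] /andP[wB _]; have := indB _ _ uB wB => /negbTE->.
by move=> /andP[vA /indep_setP indA] vw /andP[wA _]; have := indA _ _ vA wA; rewrite vw.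
Qed.

Hypotheses (r0 : forall Y, 0 <= r Y) (rn0 : r set0 = 0).

Lemma removed_ge0 v : 0 <= removed v.
Proof. by apply: sumr_ge0 => Y _; apply: divr_ge0. Qed.

Lemma sum_removed (A : {set V}) :
  \sum_(v in A) removed v = \sum_Y r Y * (#|A :&: Y|%:R / #|Y|%:R).
Proof.
rewrite /removed (exchange_big_dep xpredT) //=; apply: eq_bigr => Y _.
rewrite (eq_bigl (fun v => v \in A :&: Y)) => [|v]; last by rewrite inE.
by rewrite sumr_const -[_ *+ _]mulr_natr mulrAC mulrA.
Qed.

Lemma sum_removedT : \sum_v removed v = \sum_Y r Y.
Proof.
rewrite (eq_bigl (fun v => v \in [set: V])) => [|v]; last by rewrite inE.
rewrite sum_removed; apply: eq_bigr => Y _; rewrite setTI.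
have [->|Y0] := eqVneq Y set0; first by rewrite rn0 mul0r.
by rewrite divff ?mulr1 // pnatr_eq0 cards_eq0.
Qed.

Hypotheses (c0 : forall B, 0 <= c B) (ci : forall B, c B != 0 -> indep_set e B).

(** To first order, removal costs at most [2 * s] per unit since degrees are at most [s], and a new
    vertex gains [2 * #|B|] per unit. The product of two removals is nonnegative and is dropped; the
    mixed term costs at most the product of the total weights. *)
Lemma perturbed_edges (s : rat) : symmetric e -> (forall u, \sum_v (e u v)%:R <= s) ->
  \sum_u \sum_v (e u v)%:R - 2 * s * (\sum_Y r Y) + 2 * (\sum_B c B * #|B|%:R) -
    2 * (\sum_B c B) * (\sum_Y r Y) <=
  \sum_x \sum_y (perturbed_rel x y)%:R * (perturbed_weight x * perturbed_weight y).
Proof.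
move=> esym deg; set g := \sum_B c B; set q := \sum_Y r Y.
have mixed : \sum_u \sum_B (perturbed_rel (inl u) (inr B))%:R * ((1 - removed u) * c B) =
    \sum_B c B * #|B|%:R - \sum_B c B * (\sum_(v in B) removed v).
  rewrite exchange_big /= -sumrB; apply: eq_bigr => B _.
  have [->|cB] := eqVneq (c B) 0; first by rewrite !mul0r subrr big1 // => u _; rewrite !mulr0.
  rewrite -mulrBr -sum1_card natr_sum -sumrB mulr_sumr [RHS]big_mkcond; apply: eq_bigr => u _.
  by rewrite ci // andbT; case: (u \in B); rewrite ?mul1r ?mul0r // mulrC.
have old : \sum_u \sum_v (e u v)%:R - 2 * s * q <=
    \sum_u \sum_v (e u v)%:R * ((1 - removed u) * (1 - removed v)).
  have -> : \sum_u \sum_v (e u v)%:R * ((1 - removed u) * (1 - removed v)) =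
      \sum_u \sum_v (e u v)%:R - 2 * (\sum_u removed u * \sum_v (e u v)%:R) +
      \sum_u \sum_v (e u v)%:R * (removed u * removed v).
    have sw : \sum_u \sum_v (e u v)%:R * removed v = \sum_u removed u * \sum_v (e u v)%:R.
      rewrite exchange_big /=; apply: eq_bigr => v _; rewrite mulr_sumr.
      by apply: eq_bigr => u _; rewrite esym mulrC.
    rewrite mulrDl mul1r opprD -{2}sw addrA; rewrite -!sumrB -big_split /=; apply: eq_bigr => u _.
    rewrite mulr_sumr -!sumrB -big_split /=; apply: eq_bigr => v _; ring.
  have h1 : \sum_u removed u * \sum_v (e u v)%:R <= q * s.
    rewrite /q -sum_removedT mulr_suml; apply: ler_sum => u _.
    by apply: ler_wpM2l; [exact: removed_ge0 | exact: deg].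
  have h2 : 0 <= \sum_u \sum_v (e u v)%:R * (removed u * removed v).
    apply: sumr_ge0 => u _; apply: sumr_ge0 => v _.
    by apply: mulr_ge0; [exact: ler0n | apply: mulr_ge0; apply: removed_ge0].
  lra.
have small : \sum_B c B * (\sum_(v in B) removed v) <= g * q.
  rewrite /g mulr_suml; apply: ler_sum => B _; apply: ler_wpM2l => //.
  by rewrite /q -sum_removedT; apply: ler_sum_cond => //; apply: removed_ge0.
have -> : \sum_x \sum_y (perturbed_rel x y)%:R * (perturbed_weight x * perturbed_weight y) =
   \sum_u \sum_v (e u v)%:R * ((1 - removed u) * (1 - removed v)) +
   2 * (\sum_u \sum_B (perturbed_rel (inl u) (inr B))%:R * ((1 - removed u) * c B)).
  rewrite big_sumType /=.
  under eq_bigr do rewrite big_sumType /=.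
  rewrite big_split /= -addrA; congr (_ + _).
  rewrite mulrDl mul1r; congr (_ + _).
  rewrite [RHS]exchange_big /=; apply: eq_bigr => B _; rewrite big_sumType /=.
  rewrite [X in _ + X]big1 ?addr0 => [|C _]; last by rewrite mul0r.
  by apply: eq_bigr => u _; rewrite [c B * _]mulrC.
rewrite mixed; lra.
Qed.

(** The old vertices of [A] form an independent set [I], and a new vertex of nonzero weight in [A]
    comes from a set [B] disjoint from [I]. *)
Lemma perturbed_indep (s' : rat) :
  (forall I, indep_set e I ->
     #|I|%:R - \sum_Y r Y * (#|I :&: Y|%:R / #|Y|%:R) + \sum_(B : {set V} | [disjoint B & I]) c B <= s') ->
  forall A, indep_set perturbed_rel A -> \sum_(x in A) perturbed_weight x <= s'.
Proof.
move=> alpha A /indep_setP indA; pose I := [set v | inl v \in A].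
have indI : indep_set e I.
  by apply/indep_setP => u v; rewrite !inE => uA vA; apply: (indA (inl u) (inl v)).
apply: le_trans (alpha I indI); rewrite big_mkcond big_sumType /= -!big_mkcond /=.
apply: lerD.
  rewrite -sum_removed -sum1_card natr_sum -sumrB.
  by rewrite (eq_bigl (fun v => v \in I)) // => v; rewrite inE.
rewrite [X in X <= _]big_mkcond [X in _ <= X]big_mkcond; apply: ler_sum => B _.
case: ifP => BA; last by case: ifP.
have [->|cB] := eqVneq (c B) 0; first by rewrite if_same.
rewrite ifT //; apply/pred0P => v /=; apply/negP => /andP[vB]; rewrite inE => vA.
by have := indA (inl v) (inr B) vA BA; rewrite /= vB ci.
Qed.

Lemma perturbation (G s s' : rat) :
  ex_bound G -> symmetric e -> triangle_free_rel e ->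
  (forall u, \sum_v (e u v)%:R <= s) -> (forall v, removed v <= 1) ->
  (forall I, indep_set e I ->
     #|I|%:R - \sum_Y r Y * (#|I :&: Y|%:R / #|Y|%:R) + \sum_(B : {set V} | [disjoint B & I]) c B <= s') ->
  let g := \sum_B c B in let q := \sum_Y r Y in let n' := #|V|%:R - q + g in
  4 * n' <= 11 * s' -> 8 * s' <= 3 * n' ->
  \sum_u \sum_v (e u v)%:R - 2 * s * q + 2 * (\sum_B c B * #|B|%:R) - 2 * g * q <=
  2 * (turan_form n' s' + G * n' ^+ 2).
Proof.
move=> bound esym etf deg r1 alpha g q n' lo hi.
apply: le_trans (perturbed_edges esym deg) _.
have nE : \sum_x perturbed_weight x = n'.
  rewrite big_sumType /= /n' sumrB sum_removedT; congr (_ - _ + _).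
  by rewrite -[in RHS]sum1_card natr_sum; apply: eq_bigl => v.
have := @blowup_le_bound G _ perturbed_rel perturbed_weight s' bound (perturbed_rel_sym esym)
  (perturbed_rel_triangle_free etf) _ (perturbed_indep alpha).
rewrite nE; apply => // -[v|B] //=; by rewrite subr_ge0.
Qed.

End Perturbation.

(** All first-order terms cancel except the gain [K]. The quadratic errors add up to
    [84 = 1 + 6 + 32 + 44 + 1]: the mixed term, the three coefficients of [turan_form], and the term
    from [F <= 1]. *)
Lemma second_order_absurd (R : realFieldType) (E s mu m G q A B C D Z t u K : R) :
  G * q <= Z -> A <= Z -> C <= Z -> - B <= Z -> D <= Z -> t <= u -> 84 * Z + u < K ->
  2 * E - 2 * s * q + 2 * m - 2 * G * q <=
  2 * (E + mu * (G - q) + (m - mu * G - q * (s - mu) - K) + 6 * A + 32 * - B + 44 * C + D + t) ->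
  False.
Proof. by lra. Qed.

(* [mu] and [L] are the partial derivatives of [turan_form n s + F * n ^+ 2]. The two
   kinds of moves add a vertex with neighborhood [B] and remove weight from [Y]. *)
Lemma extremal_weights (V : finType) (e : rel V) (s : nat) (F tau kappa zeta xi rho : rat) :
  let n : rat := #|V|%:R in
  let mu := 12 * n - 32 * s%:R + 2 * F * n in let L := 8 * (11 * s%:R - 4 * n) in
  symmetric e -> triangle_free_rel e -> (forall A, indep_set e A -> (#|A| <= s)%N) ->
  \sum_u \sum_v (e u v)%:R = 2 * (turan_form n s%:R + F * n ^+ 2) ->
  ex_bound (F + tau) -> 0 < n -> 0 < L -> rho = (s%:R - mu) / L ->
  0 <= F <= 1 -> 0 <= rho -> 0 < kappa -> rho + kappa <= 1 -> 0 < zeta -> zeta <= xi -> 0 < xi ->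
  0 <= tau -> zeta <= 1 ->
  15 * zeta * n <= 11 * s%:R - 4 * n -> 11 * zeta * n <= 3 * n - 8 * s%:R ->
  (84 * zeta ^+ 2 + 4 * tau) * n ^+ 2 < L * (kappa * zeta * n) ->
  exists (lam : {set V} -> rat) (P : rat),
    [/\ forall I, 0 <= lam I, forall I, lam I != 0 -> indep_set e I, \sum_I lam I = 1 &
     [/\ \sum_I lam I * (s%:R - #|I|%:R) = P * (zeta * n),
      forall B, indep_set e B -> mu <= #|B|%:R ->
        (#|B|%:R - mu) / L - kappa + P <= \sum_(I : {set V} | [disjoint B & I]) lam I &
      forall Y : {set V}, xi * n <= #|Y|%:R ->
        \sum_I lam I * #|I :&: Y|%:R <= (rho + kappa - P) * #|Y|%:R]].
Proof.
move=> n mu L esym etf alpha eE bound n0 L0 rhoE /andP[F0 F1] rho0 k0 rk z0 zx x0 t0 z1 lo hi small.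
(* Packed: [done] would otherwise compare rational numerals by computation. *)
have num := And4 lo hi small eE; clear lo hi small eE.
pose okB (B : {set V}) := indep_set e B && (mu <= #|B|%:R).
pose okY (Y : {set V}) := xi * n <= #|Y|%:R.
pose pen (I : {set V}) := (s%:R - #|I|%:R) / (zeta * n).
have zn0 : 0 < zeta * n by rewrite mulr_gt0.
have zn : zeta * n != 0 by rewrite gt_eqF.
pose J := {I : {set V} | indep_set e I}.
(* Rows are moves, columns independent sets. An entry is the change in weight of the set, minus the
   break-even change of [s] ([(#|B| - mu) / L] or [- rho]), plus the safety margin [kappa], minus
   the scaled slack [pen]. *)
pose M (i : {set V} + {set V}) (j : J) : rat :=
  match i with
  | inl B => if okB B then ([disjoint B & val j])%:R - (#|B|%:R - mu) / L + kappa - pen (val j) else 0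
  | inr Y => if okY Y then - (#|val j :&: Y|%:R / #|Y|%:R) + rho + kappa - pen (val j) else 0
  end.
have [[g [g0 gP]]|[lam [lam0 lam1 lamP]]] := ville_alternative M; last first.
  pose lam' (I : {set V}) := if insub I is Some j then lam j else 0.
  have lamE (j : J) : lam' (val j) = lam j by rewrite /lam' valK.
  have lamS (f : {set V} -> rat) : \sum_I lam' I * f I = \sum_j lam j * f (val j).
    rewrite (bigID (indep_set e)) /= [X in _ + X]big1 ?addr0 => [|I iI]; last first.
      by rewrite /lam' (insubN _ iI) mul0r.
    rewrite (big_sub (fun I => indep_set e I)) /=.
    by apply: eq_bigr => j _; rewrite lamE.
  pose P := \sum_j lam j * pen (val j).
  exists lam', P; split.
  - by move=> I; rewrite /lam'; case: insub.
  - by move=> I; rewrite /lam'; case: insubP => // _; rewrite eqxx.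
  - have := lamS (fun=> 1); under eq_bigr do rewrite mulr1; move=> ->.
    by rewrite -[RHS]lam1; apply: eq_bigr => j _; rewrite mulr1.
  split.
  - rewrite lamS /P mulr_suml; apply: eq_bigr => j _; by rewrite /pen -mulrA (divfK zn).
  - move=> B iB mB; have := lamP (inl B); rewrite /M /okB iB mB /=.
    under eq_bigr do rewrite 3!mulrDr 2!mulrN.
    rewrite 3!big_split /= 2!sumrN -/P -!mulr_suml lam1 !mul1r.
    have -> : \sum_(I : {set V} | [disjoint B & I]) lam' I = \sum_j lam j * ([disjoint B & val j])%:R.
      rewrite -(lamS (fun I => ([disjoint B & I])%:R)) big_mkcond; apply: eq_bigr => I _.
      by case: ifP; rewrite ?mulr1 ?mulr0.
    by move: (\sum_j _) (_ / L) => a1 a2; clear; lra.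
  move=> Y xY; have := lamP (inr Y); rewrite /M /okY xY.
  have Y0 : 0 < #|Y|%:R :> rat by apply: lt_le_trans xY; rewrite mulr_gt0.
  under eq_bigr do rewrite 3!mulrDr 2!mulrN.
  rewrite 3!big_split /= 2!sumrN -/P -!mulr_suml lam1 !mul1r.
  rewrite (lamS (fun I => #|I :&: Y|%:R)).
  have -> : \sum_j lam j * (#|val j :&: Y|%:R / #|Y|%:R) = (\sum_j lam j * #|val j :&: Y|%:R) / #|Y|%:R.
    by rewrite mulr_suml; apply: eq_bigr => j _; rewrite mulrA.
  move=> h; rewrite -(ler_pdivrMr _ _ Y0); move: h; clear; lra.
exfalso.
pose gB B := if okB B then g (inl B) else 0; pose gY Y := if okY Y then g (inr Y) else 0.
have gB0 B : 0 <= gB B by rewrite /gB; case: ifP.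
have gY0 Y : 0 <= gY Y by rewrite /gY; case: ifP.
pose t := \sum_B gB B + \sum_Y gY Y.
have gP' I : indep_set e I ->
    \sum_B gB B * (([disjoint B & I])%:R - (#|B|%:R - mu) / L + kappa - pen I) +
    \sum_Y gY Y * (- (#|I :&: Y|%:R / #|Y|%:R) + rho + kappa - pen I) < 0.
  move=> iI; have := gP (exist _ I iI); rewrite big_sumType /=; congr (_ + _ < _).
    by apply: eq_bigr => B _; rewrite /gB; case: ifP => _; rewrite ?mul0r ?mulr0.
  by apply: eq_bigr => Y _; rewrite /gY; case: ifP => _; rewrite ?mul0r ?mulr0.
(* The strict inequality at the empty independent set excludes the zero combination. *)
have tp : 0 < t.
  have b0 : 0 <= \sum_B gB B by apply: sumr_ge0 => B _; apply: gB0.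
  have y0 : 0 <= \sum_Y gY Y by apply: sumr_ge0 => Y _; apply: gY0.
  rewrite lt0r (addr_ge0 b0 y0) andbT (paddr_eq0 b0 y0); apply/negP => /andP[/eqP b1 /eqP y1].
  have : indep_set e set0 by apply/indep_setP => u v; rewrite inE.
  move=> /gP'; rewrite !big1 ?addr0 ?ltxx // => [Y _|B _].
    by rewrite (psumr_eq0P (fun Y _ => gY0 Y) y1) ?mul0r.
  by rewrite (psumr_eq0P (fun B _ => gB0 B) b1) ?mul0r.
(* Scaling the combination to total size [zeta * n] turns [pen I] into the actual slack
   [s - #|I|]. *)
pose k := zeta * n / t.
have kp : 0 < k by rewrite /k divr_gt0.
pose c B := k * gB B; pose r Y := k * gY Y.
have c0 B : 0 <= c B by rewrite /c mulr_ge0 // ltW.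
have r0 Y : 0 <= r Y by rewrite /r mulr_ge0 // ltW.
have cok B : c B != 0 -> okB B by rewrite /c /gB; case: ifP; rewrite ?mulr0 ?eqxx.
have rok Y : r Y != 0 -> okY Y by rewrite /r /gY; case: ifP; rewrite ?mulr0 ?eqxx.
pose G := \sum_B c B; pose q := \sum_Y r Y.
have G0 : 0 <= G by apply: sumr_ge0.
have q0 : 0 <= q by apply: sumr_ge0.
have Gq : G + q = zeta * n.
  rewrite /G /q /c /r -!mulr_sumr -mulrDr -/t /k divfK //.
  by rewrite gt_eqF.
pose m := \sum_B c B * #|B|%:R; pose a := \sum_B c B * ((#|B|%:R - mu) / L).
have aE : L * a = m - mu * G.
  have Ln : L != 0 by rewrite gt_eqF.
  rewrite /a /m /G !mulr_sumr -sumrB; apply: eq_bigr => B _.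
  by rewrite mulrCA [L * _]mulrC (divfK Ln) mulrBr [mu * _]mulrC.
have rhoL : L * rho = s%:R - mu by rewrite rhoE mulrCA divff ?mulr1 // gt_eqF.
have a0 : 0 <= a.
  apply: sumr_ge0 => B _; have [->|/cok/andP[_ mB]] := eqVneq (c B) 0; first by rewrite mul0r.
  by apply: mulr_ge0; [exact: c0 | apply: divr_ge0; [rewrite subr_ge0 | exact: ltW]].
have a1 : a <= G * rho.
  rewrite /a /G mulr_suml; apply: ler_sum => B _.
  have [->|/cok/andP[iB _]] := eqVneq (c B) 0; first by rewrite !mul0r.
  by apply: ler_wpM2l => //; rewrite rhoE ler_pM2r ?invr_gt0 // lerD2r ler_nat alpha.
(* The independence bound moves to [s + sig], which is [kappa * (zeta * n)] below break-even. The
   excess thus gains [L * (kappa * zeta * n)] to first order, more than [small] allows. *)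
pose sig := a - q * rho - kappa * (zeta * n).
have condI I : indep_set e I -> #|I|%:R - \sum_Y r Y * (#|I :&: Y|%:R / #|Y|%:R) +
    \sum_(B : {set V} | [disjoint B & I]) c B <= s%:R + sig.
  move=> iI; have := gP' I iI; rewrite -(ltr_pM2l kp) mulr0 mulrDr !mulr_sumr.
  under eq_bigr do rewrite mulrA -/(c _) 3!mulrDr 2!mulrN.
  under [X in _ + X < _]eq_bigr do rewrite mulrA -/(r _) 3!mulrDr 2!mulrN.
  rewrite 6!big_split /= 4!sumrN -!mulr_suml -/G -/q -/a.
  have -> : \sum_B c B * ([disjoint B & I])%:R = \sum_(B : {set V} | [disjoint B & I]) c B.
    by rewrite [RHS]big_mkcond; apply: eq_bigr => B _; case: ifP; rewrite ?mulr1 ?mulr0.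
  have penE : (G + q) * pen I = s%:R - #|I|%:R by rewrite Gq /pen mulrC divfK.
  rewrite /sig -Gq; move: penE.
  move: (\sum_(B : {set V} | _) _) (\sum_Y _) => A1 A3; clear; lra.
have rn0 : r set0 = 0.
  apply/eqP; apply: contraT => /rok; rewrite /okY cards0 => h.
  by have := lt_le_trans (mulr_gt0 x0 n0) h; rewrite ltxx.
have rem1 v : removed r v <= 1.
  have xn0 : 0 < xi * n by rewrite mulr_gt0.
  apply: le_trans (_ : \sum_Y r Y / (xi * n) <= _).
    rewrite /removed big_mkcond; apply: ler_sum => Y _; case: ifP => _; last first.
      by rewrite divr_ge0 // ltW.
    have [->|/rok Yok] := eqVneq (r Y) 0; first by rewrite !mul0r.
    by apply: ler_wpM2l => //; rewrite lef_pV2 // posrE; apply: lt_le_trans Yok.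
  rewrite -mulr_suml -/q ler_pdivrMr // mul1r.
  apply: le_trans (_ : zeta * n <= _); last by rewrite ler_pM2r.
  by rewrite -Gq lerDr.
have deg u : \sum_v (e u v)%:R <= s%:R :> rat.
  rewrite (eq_bigr (fun v => if v \in [set v | e u v] then 1 else 0)) => [|v _]; last first.
    by rewrite inE; case: (e u v).
  rewrite -big_mkcond sumr_const ler_nat alpha //; apply/indep_setP => v w; rewrite !inE => uv uw.
  by apply/negP => vw; apply: (etf _ _ _ uv vw uw).
have ci B : c B != 0 -> indep_set e B by move/cok/andP=> [].
have := @perturbation V e c r r0 rn0 c0 ci _ s%:R (s%:R + sig) bound esym etf deg rem1 condI.
rewrite -/G -/q -/m; case: (num) => _ _ _ -> key0.
set z := zeta * n in zn0 Gq.
have qrho : q * rho <= q by rewrite ler_piMr //; move: rk k0; clear; lra.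
have Grho : G * rho <= G by rewrite ler_piMr //; move: rk k0; clear; lra.
have sig1 : sig <= z by rewrite /sig -/z; have := mulr_gt0 k0 zn0; have := mulr_ge0 q0 rho0; move: a1 Grho Gq q0; clear; lra.
have sig0 : - z <= sig.
  have : q * rho + kappa * z <= z.
    apply: le_trans (_ : z * rho + kappa * z <= _).
      by rewrite lerD2r; apply: ler_wpM2r => //; move: Gq G0; clear; lra.
    by rewrite [kappa * z]mulrC -mulrDr ler_piMr // ltW.
  by rewrite /sig -/z; move: a0; clear; lra.
have zlen : z <= n by rewrite /z ler_piMl // ltW.
have LsE : L * sig = m - mu * G - q * (s%:R - mu) - L * (kappa * z).
  by rewrite -rhoL -aE /sig -/z; ring.
have d1 : -z <= G - q by move: Gq G0 q0; clear; lra.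
have d2 : G - q <= z by move: Gq G0 q0; clear; lra.
have h1 : 4 * (n - q + G) <= 11 * (s%:R + sig).
  by case: num d1 d2 sig0 sig1 => lo _ _ _; move: lo; rewrite /z; clear; lra.
have h2 : 8 * (s%:R + sig) <= 3 * (n - q + G).
  by case: num d1 d2 sig0 sig1 => _ hi _ _; move: hi; rewrite /z; clear; lra.
have {key0 h1 h2} key := And3 (key0 h1 h2) isT isT.
have e1 : G * q <= z ^+ 2.
  rewrite expr2; apply: ler_pM => //; move: Gq G0 q0; clear; lra.
have z0' : 0 <= z by apply: ltW.
have sq x : - z <= x -> x <= z -> x ^+ 2 <= z ^+ 2.
  by move=> x0' x1'; rewrite -real_normK ?num_real // lerXn2r ?nnegrE // ler_norml x0' x1'.
have e2 := sq _ d1 d2; have e3 := sq _ sig0 sig1.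
have e4 : - ((G - q) * sig) <= z ^+ 2.
  have := sqr_ge0 (G - q + sig); move: e2 e3; clear; rewrite !expr2; lra.
have e5 : F * (G - q) ^+ 2 <= z ^+ 2.
  by apply: le_trans e2; rewrite ler_piMl ?sqr_ge0.
have e6 : tau * (n + (G - q)) ^+ 2 <= 4 * tau * n ^+ 2.
  have -> : 4 * tau * n ^+ 2 = tau * (n + n) ^+ 2 by ring.
  apply: ler_wpM2l => //; rewrite lerXn2r ?nnegrE //; move: d1 d2 zlen n0; clear; lra.
have Qe : turan_form (n - q + G) (s%:R + sig) + (F + tau) * (n - q + G) ^+ 2 =
    turan_form n s%:R + F * n ^+ 2 + mu * (G - q) + L * sig + 6 * (G - q) ^+ 2 +
    32 * - ((G - q) * sig) + 44 * sig ^+ 2 + F * (G - q) ^+ 2 + tau * (n + (G - q)) ^+ 2.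
  by rewrite /turan_form /mu /L; ring.
have small' : 84 * z ^+ 2 + 4 * tau * n ^+ 2 < L * (kappa * z).
  by case: num => _ _ small _; move: small; rewrite /z; clear; lra.
case: key => key _ _; move: key small'; rewrite Qe LsE; move: e1 e2 e3 e4 e5 e6; clear.
move=> e1 e2 e3 e4 e5 e6 key small'.
exact: second_order_absurd e1 e2 e3 e4 e5 e6 small' key.
Qed.

(** * The upper bound *)

(** This is the constant [b] of [independent_weights_absurd]. *)
Definition core_scale (R : realFieldType) (f : R) : R := f * (f * (2 * f / 192 / 100) / 16).

(** The tolerance [tau] for [extremal_weights], equal to [f * kappa * zeta] with [kappa = th / 16]
    and [zeta = b ^+ 2]. *)
Definition extremal_slack (R : realFieldType) (f : R) : R :=
  f * (2 * f / 192 / 100 / 16) * core_scale f ^+ 2.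

Lemma extremal_slack_gt0 (R : realFieldType) (f : R) : 0 < f -> 0 < extremal_slack f.
Proof.
move=> f0; have th0 : 0 < 2 * f / 192 / 100 by lra.
have k0 : 0 < 2 * f / 192 / 100 / 16 by lra.
apply: mulr_gt0; first exact: mulr_gt0.
by apply: exprn_gt0; apply: mulr_gt0 => //; rewrite -mulrA; apply: mulr_gt0.
Qed.

(* The quadratic bound on the excess [F] comes from [2 * ex_tf n s <= n * s]. *)
Lemma extremal_scales (R : realFieldType) (n s F f : R) :
  let th := 2 * f / 192 / 100 in let kappa := th / 16 in let b := core_scale f in
  let zeta := b ^+ 2 in let mu := 12 * n - 32 * s + 2 * F * n in
  let L := 8 * (11 * s - 4 * n) in let rho := (s - mu) / L in
  0 < n -> 4 * n <= 11 * s -> 8 * s <= 3 * n ->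
  2 * F * n ^+ 2 <= (3 * n - 8 * s) * (11 * s - 4 * n) -> 0 < f -> f <= F ->
  [/\ [/\ 22 * f * n <= 11 * s - 4 * n, 16 * f * n <= 3 * n - 8 * s, 0 < L & f * n <= n],
      [/\ 4 / 11 <= rho, rho <= 3 / 8 - 2 * f, 0 <= rho, rho + kappa <= 1 & 0 <= F <= 1],
      [/\ 0 < kappa, 0 < zeta, zeta <= f, zeta <= 1 & 0 <= extremal_slack f],
      [/\ 15 * zeta * n <= 11 * s - 4 * n, 11 * zeta * n <= 3 * n - 8 * s &
         (84 * zeta ^+ 2 + 4 * extremal_slack f) * n ^+ 2 < L * (kappa * zeta * n)] &
      forall x, s <= x + b * n -> mu <= x /\ rho - th / 8 <= (x - mu) / L - kappa].
Proof.
move=> th kappa b zeta mu L rho n0 lo hi hF f0 fF.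
set y := 3 * n - 8 * s in hF; set d := 11 * s - 4 * n in hF.
have y0 : 0 <= y by rewrite /y; move: hi; clear; lra.
have d0 : 0 <= d by rewrite /d; move: lo; clear; lra.
(* Hence [d <= n / 8] and [y <= n / 11], so the bound on [y * d] forces both factors to be at least
   a multiple of [F * n]. *)
have nE : n = 8 * d + 11 * y by rewrite /d /y; ring.
have F0 : 0 < F by apply: lt_le_trans fF.
have y1 : 16 * F * n <= y.
  have : 2 * F * n * n <= y * (n / 8).
    apply: le_trans (_ : y * d <= _); first by move: hF; rewrite expr2 mulrA.
    by apply: ler_wpM2l => //; move: nE y0; clear; lra.
  by move=> h; rewrite -(ler_pM2r n0); move: h; clear; lra.
have d1 : 22 * F * n <= d.
  have : 2 * F * n * n <= n / 11 * d.
    apply: le_trans (_ : y * d <= _); first by move: hF; rewrite expr2 mulrA.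
    by apply: ler_wpM2r => //; move: nE d0; clear; lra.
  by move=> h; rewrite -(ler_pM2r n0); move: h; clear; lra.
have Fn0 : 0 < F * n by rewrite mulr_gt0.
have dp : 0 < d by apply: lt_le_trans d1; move: Fn0; clear; lra.
have F1 : F <= 1 / 176.
  rewrite leNgt; apply/negP => h.
  have : 1 / 176 * n < F * n by rewrite ltr_pM2r.
  by move: y1 nE d0 Fn0 y0; clear; lra.
have f1 : f <= 1 / 176 by apply: le_trans fF F1.
have fFn : f * n <= F * n by rewrite ler_pM2r.
have fn0 : 0 < f * n by rewrite mulr_gt0.
have L0 : 0 < L by rewrite /L -/d; move: dp; clear; lra.
(* Thus [rho = 3 / 8 - F * n / (4 * d)]: [d <= n / 8] gives [rho <= 3 / 8 - 2 * F], and
   [d >= 22 * F * n] gives [rho >= 3 / 8 - 1 / 88 = 4 / 11]. *)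
have rhoE : rho * L = 3 * d - 2 * (F * n).
  by rewrite /rho divfK ?gt_eqF // /mu /d; ring.
have rho1 : rho <= 3 / 8 - 2 * f.
  rewrite -(ler_pM2r L0) rhoE /L -/d.
  have : f * d <= F * n / 8.
    apply: le_trans (_ : f * (n / 8) <= _); last by move: fFn; clear; lra.
    by rewrite ler_pM2l //; move: nE y0; clear; lra.
  by clear; lra.
have rho0 : 4 / 11 <= rho.
  rewrite -(ler_pM2r L0) rhoE /L -/d; move: d1; clear; lra.
have th0 : 0 < th by rewrite /th; move: f0; clear; lra.
have th1 : th <= f / 96 by rewrite /th; move: f0; clear; lra.
have k0 : 0 < kappa by rewrite /kappa; move: th0; clear; lra.
have bE : b = f * (f * kappa) by rewrite /b /core_scale /kappa /th; ring.
have fk0 : 0 < f * kappa by rewrite mulr_gt0.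
have b0 : 0 < b by rewrite bE mulr_gt0.
have bfk : b <= f * kappa by rewrite bE ler_piMl // ?ltW //; move: f1; clear; lra.
have k1 : kappa <= 1 / 176 by rewrite /kappa; move: th1 f1; clear; lra.
have b1 : b <= 1 / 176.
  apply: le_trans bfk _; apply: le_trans (_ : 1 * kappa <= _); last by rewrite mul1r.
  by rewrite ler_pM2r //; move: f1; clear; lra.
have z0 : 0 < zeta by rewrite exprn_gt0.
have zb : zeta <= b by rewrite /zeta expr2 ler_piMl ?ltW //; move: b1; clear; lra.
have zfk : zeta <= f * kappa by apply: le_trans zb bfk.
have zf : zeta <= f.
  apply: le_trans zfk _; rewrite ler_piMr ?ltW //; move: k1; clear; lra.
have znf : zeta * n <= f * n by rewrite ler_pM2r.
have small : (84 * zeta ^+ 2 + 4 * extremal_slack f) * n ^+ 2 < L * (kappa * zeta * n).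
  have -> : extremal_slack f = f * kappa * zeta by rewrite /extremal_slack -/b -/zeta /kappa /th; ring.
  have h1 : zeta ^+ 2 <= f * kappa * zeta by rewrite expr2 ler_pM2r.
  have h2 : 176 * (f * n) * (kappa * zeta * n) <= L * (kappa * zeta * n).
    rewrite ler_pM2r; last by apply: mulr_gt0 => //; apply: mulr_gt0.
    by rewrite /L -/d; move: d1 fFn; clear; lra.
  apply: lt_le_trans h2.
  have -> : 176 * (f * n) * (kappa * zeta * n) = 176 * (f * kappa * zeta) * n ^+ 2 by ring.
  rewrite ltr_pM2r ?exprn_gt0 //.
  have : 0 < f * kappa * zeta by apply: mulr_gt0.
  by move: h1; clear; lra.
have F01 : 0 <= F <= 1 by apply/andP; split; [exact: ltW | move: F1; clear; lra].
have slack0 : 0 <= extremal_slack f by rewrite /extremal_slack; apply: mulr_ge0; apply: ltW.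
split.
- by split=> //; [rewrite -/d; move: d1 fFn; clear; lra | rewrite -/y; move: y1 fFn; clear; lra | rewrite ler_piMl ?ltW //; move: f1; clear; lra].
- by split=> //; [move: rho0; clear; lra | move: rho1 k1 f0; clear; lra].
- by split=> //; move: zf f1; clear; lra.
- by split=> //; [rewrite -/d; move: znf d1 fFn fn0; clear; lra | rewrite -/y; move: znf y1 fFn fn0; clear; lra].
move=> x sx.
have bn : b * n <= f * n.
  by rewrite ler_pM2r // (le_trans bfk) // ler_piMr ?ltW //; move: k1; clear; lra.
have rL : 64 * (f * n) <= rho * L by rewrite rhoE; move: d1 fFn; clear; lra.
have rL' : rho * L = s - mu by rewrite /rho divfK ?gt_eqF.
split; first by move: rL sx bn fn0; rewrite rL'; clear; lra.
have : rho - kappa <= (x - mu) / L.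
  rewrite ler_pdivlMr // mulrBl rL'.
  have : b * n <= kappa * L.
    have -> : b * n = kappa * (f * (f * n)) by rewrite bE; ring.
    rewrite ler_pM2l //; apply: le_trans (_ : 1 * (f * n) <= _).
      by rewrite ler_pM2r //; move: f1; clear; lra.
    by rewrite /L -/d; move: d1 fFn fn0; clear; lra.
  by move: sx; clear; lra.
by rewrite /kappa; clear; lra.
Qed.

(** The measure from [extremal_weights] satisfies the hypotheses of [independent_weights_absurd]:
    [P >= 0] lets [P] be dropped from both families of bounds, and [P <= 1] bounds the mean deficit
    by [b ^+ 2 * n]. *)
Lemma near_extremal_absurd (V : finType) (e : rel V) (s : nat) (F f : rat) :
  let n : rat := #|V|%:R in
  symmetric e -> triangle_free_rel e -> (forall A, indep_set e A -> (#|A| <= s)%N) ->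
  \sum_u \sum_v (e u v)%:R = 2 * (turan_form n s%:R + F * n ^+ 2) ->
  ex_bound (F + extremal_slack f) -> 0 < n ->
  4 * n <= 11 * s%:R -> 8 * s%:R <= 3 * n ->
  2 * F * n ^+ 2 <= (3 * n - 8 * s%:R) * (11 * s%:R - 4 * n) -> 0 < f -> f <= F -> False.
Proof.
move=> n esym etf alpha eE bound n0 lo hi hF f0 fF.
have [[d1 y1 L0 fn] [rho0 rho1 rho2 rk F01] [k0 z0 zf z1 t0] [h15 h11 small] near] :=
  extremal_scales n0 lo hi hF f0 fF.
have [lam [P [lam0 lami lam1 [lamp lama lamb]]]] := extremal_weights esym etf alpha eE bound n0 L0
  (erefl _) F01 rho2 k0 rk z0 zf f0 t0 z1 h15 h11 small.
have zn0 := mulr_gt0 z0 n0.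
have P0 : 0 <= P.
  have : 0 <= P * (core_scale f ^+ 2 * n).
    rewrite -lamp; apply: sumr_ge0 => I _; have [->|/lami/alpha] := eqVneq (lam I) 0.
      by rewrite mul0r.
    by rewrite -(ler_nat rat) -subr_ge0 => h; apply: mulr_ge0 (lam0 I) h.
  by rewrite (pmulr_lge0 _ zn0).
(* For [Y] the whole vertex set, nonnegativity of the left-hand side of [lamb] gives
   [P <= rho + kappa]. *)
have P1 : P <= 1.
  have := lamb [set: V]; rewrite cardsT => /(_ fn) h.
  have := le_trans (sumr_ge0 _ (fun I _ => mulr_ge0 (lam0 I) (ler0n _ _))) h.
  by rewrite (pmulr_lge0 _ n0) subr_ge0 => h'; apply: le_trans h' rk.
apply: (independent_weights_absurd esym alpha n0 f0 d1 y1 rho0 rho1 lam0 lami lam1).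
- move=> B iB sB; have [mB h] := near _ sB.
  by apply: le_trans (lama B iB mB); apply: le_trans h _; rewrite lerDl.
- move=> Y fY; apply: le_trans (lamb Y fY) _; apply: ler_wpM2r (ler0n _ _) _ _ _.
  by rewrite gerBl.
by rewrite lamp ler_piMl ?(ltW zn0).
Qed.

Lemma turan_form_ge0 (n s : rat) : 4 * n <= 11 * s -> 8 * s <= 3 * n -> 0 <= turan_form n s.
Proof.
move=> lo hi; have -> : turan_form n s = 12 * (3 * s - n) ^+ 2 +
    8 * ((3 * s - n) * (3 * n - 8 * s)) + 2 * (3 * n - 8 * s) ^+ 2.
  by rewrite /turan_form; ring.
have x0 : 0 <= 3 * s - n by lra.
have y0 : 0 <= 3 * n - 8 * s by lra.
have := mulr_ge0 x0 y0; have := sqr_ge0 (3 * s - n); have := sqr_ge0 (3 * n - 8 * s); clear.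
lra.
Qed.

(** The difference [n * s - 2 * turan_form n s] factors as [(3 * n - 8 * s) * (11 * s - 4 * n)]. *)
Lemma excess_le (n s : nat) (F : rat) :
  (ex_tf n s)%:R = turan_form n%:R s%:R + F * n%:R ^+ 2 ->
  2 * F * n%:R ^+ 2 <= (3 * n%:R - 8 * s%:R) * (11 * s%:R - 4 * n%:R).
Proof.
have := ex_tf_degree_bound n s; rewrite -(ler_nat rat) !natrM => h exE.
move: h; rewrite exE /turan_form.
by move: (n%:R) (s%:R) => x y; clear; lra.
Qed.

Lemma excess_le1 (R : realFieldType) (n s F : R) : 0 < n -> 4 * n <= 11 * s -> 8 * s <= 3 * n ->
  2 * F * n ^+ 2 <= (3 * n - 8 * s) * (11 * s - 4 * n) -> F <= 1.
Proof.
move=> n0 lo hi h; rewrite -(ler_pM2r (mulr_gt0 n0 n0)).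
have y0 : 0 <= 3 * n - 8 * s by move: hi; clear; lra.
have d0 : 0 <= 11 * s - 4 * n by move: lo; clear; lra.
have : (3 * n - 8 * s) * (11 * s - 4 * n) <= n * n.
  by apply: ler_pM => //; move: lo hi n0; clear; lra.
have : 0 <= n * n by apply: mulr_ge0; apply: ltW.
by move: h; rewrite expr2; clear; lra.
Qed.

(* Induction on the number [k] of steps of size [extremal_slack f] by which the excess
   can still increase: it is bounded, so a counterexample leads to a near-extremal one. *)
Lemma excess_absurd (f : rat) (k n s : nat) (F : rat) : 0 < f -> (0 < n)%N ->
  (4 * n <= 11 * s)%N -> (8 * s <= 3 * n)%N ->
  (ex_tf n s)%:R = turan_form n%:R s%:R + F * n%:R ^+ 2 -> f <= F ->
  1 < F + k%:R * extremal_slack f -> False.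
Proof.
move=> f0; elim: k n s F => [|k IH] n s F n0 lo hi exE fF; have h := excess_le exE.
all: have n0' : 0 < n%:R :> rat by rewrite ltr0n.
all: have lo' : 4 * n%:R <= 11 * s%:R :> rat by move: lo; rewrite -(ler_nat rat) !natrM.
all: have hi' : 8 * s%:R <= 3 * n%:R :> rat by move: hi; rewrite -(ler_nat rat) !natrM.
  by rewrite mul0r addr0 ltNge (excess_le1 n0' lo' hi' h).
move=> kF.
have tf0 := turan_form_ge0 lo' hi'.
have Fn : 0 < F * n%:R ^+ 2 by apply: mulr_gt0; [apply: lt_le_trans fF | apply: exprn_gt0].
have ex0 : (0 < ex_tf n s)%N by rewrite -(ltr_nat rat) exE; apply: ltr_wpDl.
have [E /and3P[sE tE /forallP aE] EE] := ex_tf_attained ex0.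
have cardn : #|'I_n|%:R = n%:R :> rat by rewrite card_ord.
apply: (@near_extremal_absurd 'I_n (adj E) s F f (@adj_sym _ E) (triangle_free_adj tE));
  rewrite ?cardn //.
- by move=> A indA; apply: (implyP (aE A)).
- rewrite -exE -EE -natrM -sum_adj // natr_sum; apply: eq_bigr => u _.
  by rewrite natr_sum.
(* This is [ex_bound (F + extremal_slack f)]: a violation at [(n', s')] has an excess larger by more
   than one step and falls under the induction hypothesis. *)
move=> n' s' lo1 hi1; rewrite leNgt; apply/negP => big.
have lo1' : 4 * n'%:R <= 11 * s'%:R :> rat by move: lo1; rewrite -(ler_nat rat) !natrM.
have hi1' : 8 * s'%:R <= 3 * n'%:R :> rat by move: hi1; rewrite -(ler_nat rat) !natrM.
case: (posnP n') => [n'0|n'0].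
  move: big; rewrite n'0; have := ex_tf_degree_bound 0 s'; rewrite mul0n leqn0 muln_eq0 /= => /eqP->.
  rewrite expr0n mulr0 addr0 ltNge; move: lo1' hi1'; rewrite n'0 => lo2 hi2.
  by rewrite (turan_form_ge0 lo2 hi2).
have n2 : 0 < n'%:R ^+ 2 :> rat by rewrite exprn_gt0 // ltr0n.
pose F' := ((ex_tf n' s')%:R - turan_form n'%:R s'%:R) / n'%:R ^+ 2.
have exE' : (ex_tf n' s')%:R = turan_form n'%:R s'%:R + F' * n'%:R ^+ 2.
  by rewrite /F' divfK ?gt_eqF // addrC subrK.
have FF' : F + extremal_slack f < F'.
  by move: big; rewrite exE' ltrD2l ltr_pM2r.
apply: (IH n' s' F' n'0 lo1 hi1 exE').
  apply: le_trans fF (le_trans _ (ltW FF')).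
  by rewrite lerDl; apply: ltW (extremal_slack_gt0 f0).
by apply: lt_trans kF _; rewrite -natr1 mulrDl mul1r addrCA addrC ltrD2r.
Qed.

Lemma ex_tf_upper (n s : nat) : (4 * n <= 11 * s)%N -> (8 * s <= 3 * n)%N ->
  (ex_tf n s)%:R <= turan_form n%:R s%:R.
Proof.
move=> lo hi; rewrite leNgt; apply/negP => big.
have lo' : 4 * n%:R <= 11 * s%:R :> rat by move: lo; rewrite -(ler_nat rat) !natrM.
have hi' : 8 * s%:R <= 3 * n%:R :> rat by move: hi; rewrite -(ler_nat rat) !natrM.
case: (posnP n) => [n0|n0].
  move: big; have := ex_tf_degree_bound n s; rewrite n0 mul0n leqn0 muln_eq0 /= => /eqP->.
  by move: lo' hi'; rewrite n0 => lo2 hi2; rewrite ltNge (turan_form_ge0 lo2 hi2).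
have n0' : 0 < n%:R :> rat by rewrite ltr0n.
have n2 : 0 < n%:R ^+ 2 :> rat by rewrite exprn_gt0.
pose F := ((ex_tf n s)%:R - turan_form n%:R s%:R) / n%:R ^+ 2.
have exE : (ex_tf n s)%:R = turan_form n%:R s%:R + F * n%:R ^+ 2.
  by rewrite /F divfK ?gt_eqF // addrC subrK.
have F0 : 0 < F by rewrite divr_gt0 // subr_gt0.
have slack0 := extremal_slack_gt0 F0.
have [k kP] : exists k : nat, 1 / extremal_slack F < k%:R.
  exists (Num.bound (1 / extremal_slack F)); apply: archi_boundP.
  by rewrite divr_ge0 // ltW.
apply: (@excess_absurd F k n s F F0 n0 lo hi exE (lexx F)).
move: kP; rewrite ltr_pdivrMr // => kP.
by apply: lt_le_trans kP _; rewrite lerDr ltW.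
Qed.

(** * The lower bound *)

(** The Andrasfai graph on 11 vertices, in circulant form. Adding [11] first keeps the natural
    subtraction from truncating. *)
Definition andrasfai_rel : rel nat := fun i j => (4 <= (i + 11 - j) %% 11 <= 7)%N.

Definition light_class (i : nat) : bool := i \in [:: 0; 4; 8]%N.

Lemma andrasfai_sym : all (fun i => all (fun j => andrasfai_rel i j == andrasfai_rel j i)
  (iota 0 11)) (iota 0 11).
Proof. by vm_compute. Qed.

Lemma andrasfai_triangle_free : all (fun i => all (fun j => all (fun k =>
  ~~ [&& andrasfai_rel i j, andrasfai_rel j k & andrasfai_rel i k])
  (iota 0 11)) (iota 0 11)) (iota 0 11).
Proof. by vm_compute. Qed.

Definition andrasfai_indep (b : seq bool) : bool :=
  find_all (fun i => find_all (fun j =>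
    if nth false b i then if nth false b j then ~~ andrasfai_rel i j else true else true)
  (iota 0 11)) (iota 0 11).

Lemma andrasfai_indep_counts : find_all (fun b =>
  if andrasfai_indep b then
    (count (fun i => nth false b i && ~~ light_class i) (iota 0 11) <= 3)%N &&
    (count (nth false b) (iota 0 11) <= 4)%N
  else true) (bitseqs 11).
Proof. by vm_compute. Qed.

Lemma mem_bitseqs (b : seq bool) : b \in bitseqs (size b).
Proof.
elim: b => // a b IH; rewrite /= cats0 mem_cat.
by case: a; rewrite map_f ?orbT.
Qed.

(** By enumeration of all subsets, an independent set has at most four vertices, at most three of
    them heavy. Since [y <= x], the worst case is three heavy classes and one light class. *)
Lemma andrasfai_indep_weight (x y : nat) (A : {set 'I_11}) : (y <= x)%N ->
  indep_set (fun i j : 'I_11 => andrasfai_rel i j) A ->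
  (\sum_(i in A) (if light_class i then y else x) <= 3 * x + y)%N.
Proof.
move=> yx /indep_setP indA.
pose b := mkseq (fun i => inord i \in A) 11.
have bE i : (i < 11)%N -> nth false b i = (inord i \in A) by move=> i11; rewrite nth_mkseq.
have := andrasfai_indep_counts; rewrite find_allE => /allP/(_ b).
have bb : b \in bitseqs 11 by rewrite -(size_mkseq (fun i => inord i \in A) 11) mem_bitseqs.
move=> /(_ bb).
have -> : andrasfai_indep b.
  rewrite /andrasfai_indep find_allE; apply/allP => i; rewrite mem_iota add0n => /andP[_ i11].
  rewrite find_allE; apply/allP => j; rewrite mem_iota add0n => /andP[_ j11].
  rewrite !bE //; case: ifP => // iA; case: ifP => // jA.
  by have := indA _ _ iA jA; rewrite !inordK.
have cnt (P : pred nat) (c : nat) : (\sum_(i in A | P i) c = count (fun i => nth false b i && P i) (iota 0 11) * c)%N.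
  rewrite sum_nat_const; congr (_ * _)%N; rewrite -sum1_card -sum1_count.
  rewrite -[iota 0 11]/(index_iota 0 11) big_mkord; apply: eq_bigl => i.
  by rewrite bE // inord_val.
have -> : (\sum_(i in A) (if light_class i then y else x) =
  count (fun i => nth false b i && light_class i) (iota 0 11) * y +
  count (fun i => nth false b i && ~~ light_class i) (iota 0 11) * x)%N.
  rewrite (bigID (fun i : 'I_11 => light_class i)) /= -(cnt light_class y) -(cnt (fun i => ~~ light_class i) x); congr (_ + _)%N.
    by apply: eq_bigr => i /andP[_ ->].
  by apply: eq_bigr => i /andP[_ /negbTE->].
have -> : count (nth false b) (iota 0 11) =
  (count (fun i => nth false b i && light_class i) (iota 0 11) +
   count (fun i => nth false b i && ~~ light_class i) (iota 0 11))%N.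
  elim: (iota 0 11) => //= i r ->.
  by case: (nth false b i); case: (light_class i) => /=; move: (count _ r) (count _ r) => p q; clear; lia.
move: (count _ _) (count _ _) => p q /andP[q3 pq4].
have [k kE] : exists k, (3 = q + k)%N by exists (3 - q)%N; rewrite subnKC.
have pk : (p <= k + 1)%N by move: q3 pq4 kE; clear; lia.
rewrite kE; apply: leq_trans (_ : (k + 1) * y + q * x <= _)%N; first by rewrite leq_add2r leq_mul2r pk orbT.
have : (k * y <= k * x)%N by rewrite leq_mul2l yx orbT.
by clear; nia.
Qed.

Lemma andrasfai_edges (x y : nat) : let w i := if light_class i then y else x in
  (\sum_(i < 11) \sum_(j < 11) andrasfai_rel i j * (w i * w j) =
   2 * (12 * (x * x) + 8 * (x * y) + 2 * (y * y)))%N.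
Proof.
move=> w; under eq_bigr do rewrite !big_ord_recl big_ord0 /=.
rewrite !big_ord_recl big_ord0 /= /w /light_class /= /andrasfai_rel /=.
by clear; nia.
Qed.

Lemma ex_tf_lower (n s : nat) : (4 * n <= 11 * s)%N -> (8 * s <= 3 * n)%N ->
  turan_form n%:R s%:R <= (ex_tf n s)%:R.
Proof.
move=> lo hi.
(* The inverse of [n = 8 * x + 3 * y], [s = 3 * x + y]; the hypotheses prevent truncation. *)
pose x := (3 * s - n)%N; pose y := (3 * n - 8 * s)%N.
have yx : (y <= x)%N by rewrite /x /y; move: lo hi; clear; lia.
have nE : n = (8 * x + 3 * y)%N by rewrite /x /y; move: lo hi; clear; lia.
have sE : s = (3 * x + y)%N by rewrite /x /y; move: lo hi; clear; lia.
pose w (i : 'I_11) := if light_class i then y else x.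
pose e : rel 'I_11 := fun i j => andrasfai_rel i j.
have mem (i : 'I_11) : nat_of_ord i \in iota 0 11 by rewrite mem_iota ltn_ord.
have esym : symmetric e.
  by move=> i j; apply/eqP; apply: (allP (allP andrasfai_sym i (mem i)) j (mem j)).
have etf : triangle_free_rel e.
  move=> i j k ij jk ik.
  have := allP (allP (allP andrasfai_triangle_free i (mem i)) j (mem j)) k (mem k).
  by rewrite -/(e i j) -/(e j k) -/(e i k) ij jk ik.
have := blowup_le_ex_tf (w := w) esym etf (fun A => @andrasfai_indep_weight x y A yx).
have -> : (\sum_(i < 11) w i = n)%N.
  rewrite !big_ord_recl big_ord0 /w /light_class /= nE; clear; lia.
rewrite -sE (andrasfai_edges x y) leq_pmul2l // -(ler_nat rat); apply: le_trans.
rewrite nE sE /turan_form !natrD !natrM; move: (x%:R : rat) (y%:R : rat) => a b.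
by clear; lra.
Qed.

Theorem theorem1p2 (n s : nat) (hsn : (s <= n)%N)
    (hlo : 4 * n%:Q / 11 <= s%:Q) (hhi : s%:Q <= 3 * n%:Q / 8) :
  (ex_tf n s)%:Z = 6 * n%:Z ^+ 2 - 32 * (n%:Z * s%:Z) + 44 * s%:Z ^+ 2.
Proof.
have lo : (4 * n <= 11 * s)%N.
  by rewrite -(ler_nat rat) !natrM; move: hlo; rewrite -!pmulrn; clear; lra.
have hi : (8 * s <= 3 * n)%N.
  by rewrite -(ler_nat rat) !natrM; move: hhi; rewrite -!pmulrn; clear; lra.
apply: (intr_inj (R := rat)).
rewrite !(rmorphD, rmorphN, rmorphM, rmorphXn) /= -!pmulrn.
by apply/eqP; rewrite eq_le; apply/andP; split; [apply: ex_tf_upper | apply: ex_tf_lower].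
Qed.
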